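(* Let $a=\frac{71}{100}$ and $$\Gamma_0=a\begin{pmatrix}1&1\\-1&1\end{pmatrix}\mathbb{Z}^2\subset\mathbb{R}^2.$$ There exists a nonzero $g_0\in C_c^\infty(\mathbb{R})$ such that $\mathcal{G}(g_0,\Gamma_0)$ is an orthonormal system. Consequently, if $$\Lambda_0=\Gamma_0^\circ=\frac1{2a}\begin{pmatrix}1&-1\\1&1\end{pmatrix}\mathbb{Z}^2,$$ then $g=\sqrt{\operatorname{covol}(\Lambda_0)}\,g_0$ belongs to $C_c^\infty(\mathbb{R})$ and $\mathcal{G}(g,\Lambda_0)$ is a Parseval frame. Moreover, $$\Lambda_0=cS\mathbb{Z}^2,\qquad c=\frac1{\sqrt2\,a},\qquad S=\frac1{\sqrt2}\begin{pmatrix}1&-1\\1&1\end{pmatrix}\in\mathrm{Sp}(2,\mathbb{R}),$$ and every entry of $S$ is nonzero.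
   Context: For $x,\xi,t\in\mathbb{R}$: $(T_xf)(t)=f(t-x)$, $(M_\xi f)(t)=e^{2\pi i\xi t}f(t)$, $\pi(x,\xi)=M_\xi T_x$, and $\mathcal{G}(g,\Lambda)=\{\pi(\lambda)g:\lambda\in\Lambda\}$ for a full-rank lattice $\Lambda\subset\mathbb{R}^2$. $\mathcal{G}(g,\Lambda)$ is a Parseval frame if $\sum_{\lambda\in\Lambda}|\langle f,\pi(\lambda)g\rangle|^2=\|f\|_2^2$ for all $f\in L^2(\mathbb{R})$. $\operatorname{covol}(M\mathbb{Z}^2)=|\det M|$. The adjoint lattice is $\Lambda^\circ=\{z\in\mathbb{R}^2:\sigma(z,\lambda)\in\mathbb{Z}\ \forall\lambda\in\Lambda\}$ with $\sigma((x,\xi),(y,\eta))=\eta x-\xi y$. $\mathrm{Sp}(2,\mathbb{R})=\{S\in GL_2(\mathbb{R}):S^TJS=J\}$, $J=\begin{pmatrix}0&1\\-1&0\end{pmatrix}$. *)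

(* Defs.v *)
From mathcomp Require Import all_boot all_order all_algebra.
From mathcomp Require Import all_classical all_reals all_analysis.
From mathcomp Require Import complex.

Set Implicit Arguments.
Unset Strict Implicit.
Unset Printing Implicit Defensive.

Import Order.TTheory GRing.Theory Num.Theory.
Import numFieldNormedType.Exports.

Local Open Scope classical_set_scope.
Local Open Scope ring_scope.
Local Open Scope complex_scope.

Section Functions.
Context {R : realType}.
Local Notation mu := (@lebesgue_measure R).
Implicit Types f g h : R -> R[i].

Definition sqnorm f : \bar R :=
  (\int[mu]_t ((Normc.normc (f t)) ^+ 2)%:E)%E.

(* Membership in L^2(R), for representatives rather than almost-everywhere
   classes. *)
Definition square_integrable f : Prop :=
  [/\ measurable_fun setT (fun t => complex.Re (f t)),
      measurable_fun setT (fun t => complex.Im (f t)) &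
      (sqnorm f < +oo)%E].

(* Integral of a complex function, componentwise; meaningful when both
   components are integrable. *)
Definition Cintegral f : R[i] :=
  (\int[mu]_t complex.Re (f t))%R +i* (\int[mu]_t complex.Im (f t))%R.

(* Linear in the first argument, as in <f, pi(lambda) g>. *)
Definition inner f h : R[i] := Cintegral (fun t => f t * conjc (h t)).

Definition smooth f : Prop := forall (n : nat) (t : R),
  derivable (derive1n n (fun s => complex.Re (f s))) t 1 /\
  derivable (derive1n n (fun s => complex.Im (f s))) t 1.

Definition compactly_supported f : Prop :=
  compact (closure [set t : R | f t != 0]).

Definition Cc_infty f : Prop := smooth f /\ compactly_supported f.

(* Systems are families (e i) indexed by i in I, so distinct indices are
   required to give orthogonal, hence distinct, vectors. *)
Definition orthonormal_system (I : choiceType) (A : set I)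
    (e : I -> R -> R[i]) : Prop :=
  (forall i, A i -> square_integrable (e i)) /\
  (forall i j, A i -> A j -> inner (e i) (e j) = (i == j)%:R).

Definition parseval_frame (I : choiceType) (A : set I)
    (e : I -> R -> R[i]) : Prop :=
  (forall i, A i -> square_integrable (e i)) /\
  (forall f, square_integrable f ->
    (\esum_(i in A) ((Normc.normc (inner f (e i))) ^+ 2)%:E)%E = sqnorm f).

Definition translation (x : R) f : R -> R[i] := fun t => f (t - x).

Definition modulation (xi : R) f : R -> R[i] :=
  fun t => (cos (2 * pi * xi * t) +i* sin (2 * pi * xi * t)) * f t.

(* The time-frequency plane R^2 is 'cV[R]_2, with (x, xi) = (z 0 0, z 1 0). *)
Definition tfshift (z : 'cV[R]_2) f : R -> R[i] :=
  modulation (z 1 0) (translation (z 0 0) f).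

Definition gabor g : 'cV[R]_2 -> R -> R[i] := fun z => tfshift z g.

End Functions.

Section Lattices.
Context {R : realType}.
Implicit Types (M N S : 'M[R]_2) (L : set 'cV[R]_2).

Definition mat2 (a b c d : R) : 'M[R]_2 :=
  \matrix_(i, j) if i == 0 then (if j == 0 then a else b)
                 else (if j == 0 then c else d).

(* M Z^2; a full-rank lattice when M \in unitmx. *)
Definition lattice M : set 'cV[R]_2 :=
  [set M *m map_mx intr k | k in [set: 'cV[int]_2]].

Definition sigma (z w : 'cV[R]_2) : R := w 1 0 * z 0 0 - z 1 0 * w 0 0.

Definition adjoint_lattice L : set 'cV[R]_2 :=
  [set z | forall w, L w -> sigma z w \is a Num.int].

(* |det M| for any basis M of L: see covol_lattice for independence of M. *)
Definition covol L : R :=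
  xget 0 [set v | exists2 M : 'M[R]_2,
                    M \in unitmx /\ L = lattice M & v = `|\det M|].

Definition Jmx : 'M[R]_2 := mat2 0 1 (- 1) 0.

Definition Sp2 : set 'M[R]_2 :=
  [set S | S \in unitmx /\ S^T *m Jmx *m S = Jmx].

Lemma lattice_sub M N : lattice M `<=` lattice N ->
  exists P : 'M[int]_2, M = N *m map_mx intr P.
Proof.
move=> MN.
have /choice[p Hp] : forall j : 'I_2, exists k : 'cV[int]_2,
    N *m map_mx intr k = col j M.
  move=> j; have [|k _ <-] := MN (col j M); last by exists k.
  exists (delta_mx j 0) => //; rewrite map_delta_mx; exact/esym/colE.
exists (\matrix_(i, j) p j i 0); apply/matrixP => i j.
have /matrixP/(_ i 0) := Hp j; rewrite !mxE => <-.
by apply: eq_bigr => k _; rewrite !mxE.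
Qed.

Lemma covol_lattice M : M \in unitmx -> covol (lattice M) = `|\det M|.
Proof.
have le1 A B : A \in unitmx -> B \in unitmx -> lattice A `<=` lattice B ->
    `|\det B| <= `|\det A|.
  move=> uA uB /lattice_sub[P eA]; move: uA.
  rewrite eA unitmxE det_mulmx det_map_mx unitfE mulf_eq0 intr_eq0 negb_or.
  move=> /andP[_ P0]; rewrite normrM ler_peMr// -intr_norm ler1z.
  by rewrite -gtz0_ge1 normr_gt0.
move=> uM; rewrite /covol; case: xgetP => [v -> [N [uN eN] ->]|/(_ `|\det M|)].
  by apply/eqP; rewrite eq_le !le1// eN.
by case; exists M.
Qed.

End Lattices.

(* Main.v *)
Require Import Defs.
From mathcomp Require Import all_boot all_order all_algebra.
From mathcomp Require Import all_classical all_reals all_analysis.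
From mathcomp Require Import complex.
From mathcomp Require Import measurable_realfun zify ring lra.
Set Implicit Arguments.
Unset Strict Implicit.
Unset Printing Implicit Defensive.
Import Order.TTheory GRing.Theory Num.Theory.
Import numFieldNormedType.Exports.
Local Open Scope classical_set_scope.
Local Open Scope ring_scope.
Local Open Scope complex_scope.

(** Multiplication by the chirp [t |-> exp (i pi t^2)] shears the
    time-frequency plane and preserves smoothness and compact support. The
    quincunx lattice [Gamma0], whose points are [(a m, a m + 2 a n)], is the
    image under this shear of the rectangular lattice [a Z x 2 a Z], and
    [Lambda0] is the image of [al Z x (1 / a) Z] with [al = 1 / (2 a)]. So it
    suffices to find a window [h] for the rectangular lattices; then
    [g0 t = exp (i pi t^2) h t].

    Since [2 a^2 > 1], the length [a] exceeds [al], and [h] can be supported in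
    [[0, a]] with the squares of its [al]-translates adding up to a constant:
    [h t = sqrt (2 a) * sin (pi / 2 * S t) * cos (pi / 2 * S (t - al))] for a
    smooth step [S] going from 0 to 1 on [[0, a - al]]. Here
    [al * h t ^+ 2 = th t - th (t - al)] with [th = sin^2 (pi / 2 * S)]
    ([smooth_window]), a telescoping identity from which everything follows.

    Orthonormality ([orthonormal_gabor_chirp]): distinct translates by [a Z]
    have disjoint supports, and within one translate the telescoping identity
    turns the integral of [h^2] against a character of period [al] into the
    integral of the character over a full period ([window_periodization]).

    Parseval property ([parseval_gabor_chirp]): for a fixed translate, the
    coefficients of [f] are the Fourier coefficients, on an interval of
    length [a], of [f] times the translated window and a unimodular factor, so
    Parseval's identity ([fourier_parseval], [gabor_chirp_fiber]) sums them to
    an integral of [|f|^2] against the squared window. The squared windows add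
    up to a constant ([window_sum]).

    As to Parseval's identity for the trigonometric system, Bessel's equality
    reduces it to the density of trigonometric polynomials in L2
    ([approximable_parseval]). Indicators of rays are bounded pointwise limits
    of trigonometric polynomials ([approximable_ray]), and a Dynkin argument
    followed by approximation by simple functions reaches all of L2
    ([approximable_all]). *)

(** * Square-integrable functions on a set *)

Section L2.
Context d (T : measurableType d) (R : realType).
Variables (mu : {measure set T -> \bar R}) (D : set T).
Hypothesis mD : measurable D.
Implicit Types (u v w : T -> R) (c : R).

(** A predicate on representatives, relative to a set [D]: working with actual
    functions avoids passing to almost-everywhere classes. *)
Definition L2 u := measurable_fun D u /\
  mu.-integrable D (EFin \o (fun x => u x ^+ 2)).

Definition dot u v : R := \int[mu]_(x in D) (u x * v x).

(** By [2 |u v| <= u^2 + v^2]. *)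
Lemma L2_mul u v : L2 u -> L2 v ->
  mu.-integrable D (EFin \o (fun x => u x * v x)).
Proof.
move=> [mu_ iu] [mv iv].
apply: (@le_integrable _ _ _ mu D mD _ (EFin \o (fun x => u x ^+ 2 + v x ^+ 2))).
- by apply/measurable_EFinP; exact: measurable_funM.
- move=> x Dx /=; rewrite lee_fin [leRHS]ger0_norm ?addr_ge0 ?sqr_ge0//.
  rewrite normrM -(real_normK (num_real (u x))) -(real_normK (num_real (v x))).
  have := normr_ge0 (u x); have := normr_ge0 (v x).
  by nra.
- by have := integrableD mD iu iv.
Qed.

Lemma L2D u v : L2 u -> L2 v -> L2 (fun x => u x + v x).
Proof.
move=> Lu Lv; split; first exact: measurable_funD Lu.1 Lv.1.
have -> : EFin \o (fun x => (u x + v x) ^+ 2) =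
   (EFin \o (fun x => u x ^+ 2 + 2 * (u x * v x))) \+ (EFin \o fun x => v x ^+ 2).
  by apply/funext => x /=; rewrite -EFinD; congr EFin; ring.
apply: integrableD => //; last by case: Lv.
have := integrableD mD Lu.2 (integrableZl mD 2 (L2_mul Lu Lv)).
by [].
Qed.

Lemma L2Z c u : L2 u -> L2 (fun x => c * u x).
Proof.
move=> [m_u iu]; split; first exact: measurable_funM.
have -> : EFin \o (fun x => (c * u x) ^+ 2) =
    fun x => ((c ^+ 2)%:E * (u x ^+ 2)%:E)%E.
  by apply/funext => x /=; rewrite -EFinM exprMn.
exact: integrableZl.
Qed.

Lemma L2B u v : L2 u -> L2 v -> L2 (fun x => u x - v x).
Proof.
move=> Lu Lv; have := L2D Lu (L2Z (-1) Lv).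
by under [X in L2 X]eq_fun do rewrite mulN1r.
Qed.

Lemma dotC u v : dot u v = dot v u.
Proof. by rewrite /dot; under eq_Rintegral do rewrite mulrC. Qed.

Lemma dot_ge0 u : 0 <= dot u u.
Proof. by apply: Rintegral_ge0 => x _; rewrite -expr2 sqr_ge0. Qed.

Lemma dotDl u v w : L2 u -> L2 v -> L2 w ->
  dot (fun x => u x + v x) w = dot u w + dot v w.
Proof.
move=> Lu Lv Lw; rewrite /dot -RintegralD//; try exact: L2_mul.
by under eq_Rintegral do rewrite mulrDl.
Qed.

Lemma dotZl c u w : L2 u -> L2 w -> dot (fun x => c * u x) w = c * dot u w.
Proof.
move=> Lu Lw; rewrite /dot -RintegralZl//; last exact: L2_mul.
by under eq_Rintegral do rewrite -mulrA.
Qed.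

Lemma dotBl u v w : L2 u -> L2 v -> L2 w ->
  dot (fun x => u x - v x) w = dot u w - dot v w.
Proof.
move=> Lu Lv Lw; rewrite -[- dot v w]mulN1r -dotZl// -dotDl//; last exact: L2Z.
by under [in RHS]eq_fun do rewrite mulN1r.
Qed.

Lemma dot_subZ u v c : L2 u -> L2 v ->
  dot (fun x => u x - c * v x) (fun x => u x - c * v x) =
  dot u u - 2 * c * dot u v + c ^+ 2 * dot v v.
Proof.
move=> Lu Lv; have Lcv := L2Z c Lv; have Ld := L2B Lu Lcv.
rewrite dotBl// [dot u (fun=> _)]dotC [dot (fun=> _ * _) (fun=> _ - _)]dotC.
rewrite !dotBl// [dot u (fun=> _ * _)]dotC !dotZl//.
rewrite [dot v (fun=> _ * _)]dotC dotZl// [dot v u]dotC; ring.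
Qed.

(** Parallelogram law with one term dropped; it replaces the triangle
    inequality, so that no square roots of [dot] are needed. *)
Lemma dotD_le u v : L2 u -> L2 v ->
  dot (fun x => u x + v x) (fun x => u x + v x) <= 2 * dot u u + 2 * dot v v.
Proof.
move=> Lu Lv.
have := dot_subZ 1 Lu Lv; have := dot_subZ (-1) Lu Lv.
under [X in dot X X]eq_fun do rewrite mulN1r opprK.
move=> ->; have := dot_ge0 (fun x => u x - 1 * v x) => + E; rewrite E; lra.
Qed.

End L2.

(** * Orthogonal families and Parseval's identity *)

Section OrthogonalFamily.
Context d (T : measurableType d) (R : realType).
Variables (mu : {measure set T -> \bar R}) (D : set T).
Hypothesis mD : measurable D.
Local Notation L2 := (L2 mu D).
Local Notation dot := (dot mu D).
Variables (I : choiceType) (e : I -> T -> R) (L : R).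
Hypothesis L0 : 0 < L.
Hypothesis L2e : forall i, L2 (e i).
Hypothesis orth_e : forall i j, dot (e i) (e j) = L * (i == j)%:R.
Implicit Types (u v w : T -> R) (c : I -> R) (s : seq I).

Definition lincomb s c : T -> R := fun x => \sum_(i <- s) c i * e i x.

Lemma lincombS i s c :
  lincomb (i :: s) c = fun x => lincomb s c x + c i * e i x.
Proof. by apply/funext => x; rewrite /lincomb big_cons addrC. Qed.

Lemma lincomb0 c : lincomb [::] c = fun=> 0.
Proof. by apply/funext => x; rewrite /lincomb big_nil. Qed.

Lemma L2_0 : L2 (fun=> 0).
Proof.
split; first exact: measurable_cst.
rewrite [X in integrable _ _ X](_ : _ = cst 0%E); first exact: integrable0.
by apply/funext => x /=; rewrite expr0n.
Qed.

Lemma L2_lincomb s c : L2 (lincomb s c).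
Proof.
elim: s => [|i s IH]; first by rewrite lincomb0; exact: L2_0.
by rewrite lincombS; apply: L2D => //; exact: L2Z.
Qed.

Lemma dot_lincomb s c u : L2 u ->
  dot (lincomb s c) u = \sum_(i <- s) c i * dot u (e i).
Proof.
move=> Lu; elim: s => [|i s IH].
  rewrite lincomb0 big_nil /dot.
  under eq_Rintegral do rewrite mul0r.
  by rewrite /Rintegral integral0_eq.
rewrite lincombS dotDl//; [|exact: L2_lincomb|exact: L2Z].
by rewrite dotZl// IH big_cons addrC [dot (e i) u]dotC.
Qed.

Lemma dot_lincomb_e s c i : uniq s -> i \in s -> dot (lincomb s c) (e i) = L * c i.
Proof.
move=> us si; rewrite dot_lincomb// (bigD1_seq i)//= big1 => [|j ji].
  by rewrite orth_e eqxx mulr1 addr0 mulrC.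
by rewrite orth_e eq_sym (negbTE ji) !mulr0.
Qed.

(** Bessel's equality. The last sum vanishes for the Fourier coefficients,
    which gives Bessel's inequality, and is nonnegative for any other choice,
    which says that the Fourier partial sum is the best approximation. *)
Lemma dot_sub_lincomb s c u : uniq s -> L2 u ->
  dot (fun x => u x - lincomb s c x) (fun x => u x - lincomb s c x) =
  dot u u - L^-1 * \sum_(i <- s) dot u (e i) ^+ 2
   + L^-1 * \sum_(i <- s) (dot u (e i) - L * c i) ^+ 2.
Proof.
move=> us Lu; have Ls := L2_lincomb s c.
have E : dot (fun x => u x - lincomb s c x) (fun x => u x - lincomb s c x) =
    dot u u - 2 * dot (lincomb s c) u + dot (lincomb s c) (lincomb s c).
  have := dot_subZ mD 1 Lu Ls; under [X in dot X X]eq_fun do rewrite mul1r.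
  by move=> ->; rewrite [dot u (lincomb _ _)]dotC expr1n mul1r mulr1.
rewrite E !dot_lincomb//.
under [X in _ + X = _]eq_big_seq => i si do rewrite dot_lincomb_e//.
rewrite -!addrA; congr (_ + _); rewrite !mulr_sumr -!sumrN -!big_split/=.
by apply: eq_bigr => i _; field; rewrite gt_eqF.
Qed.

Lemma bessel s u : uniq s -> L2 u ->
  \sum_(i <- s) dot u (e i) ^+ 2 <= L * dot u u.
Proof.
move=> us Lu; have := dot_sub_lincomb (fun i => L^-1 * dot u (e i)) us Lu.
rewrite [X in _ + _ * X]big1 => [|i _]; last first.
  by rewrite mulrA divff ?gt_eqF// mul1r subrr expr0n.
have := dot_ge0 mu D (fun x => u x - lincomb s (fun i => L^-1 * dot u (e i)) x).
move=> + E; rewrite {}E mulr0 addr0 subr_ge0 => h.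
by rewrite -(ler_pM2l (x := L^-1)) ?invr_gt0// mulKf ?gt_eqF.
Qed.

(** Repeated indices are allowed in the list, so that closure under sums is
    concatenation; [inspan_lincomb] collects the repetitions afterwards. *)
Definition inspan u := exists l : seq (R * I),
  u = fun x => \sum_(p <- l) p.1 * e p.2 x.

Lemma inspan_lincomb u : inspan u -> exists s c, uniq s /\ u = lincomb s c.
Proof.
move=> [l ->]; exists (undup (map snd l)).
exists (fun i => \sum_(p <- l | p.2 == i) p.1); split; first exact: undup_uniq.
apply/funext => x; rewrite /lincomb.
under [RHS]eq_bigr do rewrite mulr_suml big_mkcond/=.
rewrite exchange_big/=; apply: eq_big_seq => p pl.
rewrite (bigD1_seq p.2) ?undup_uniq//=; last first.
  by rewrite mem_undup; apply/mapP; exists p.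
by rewrite eqxx big1 ?addr0// => i; rewrite eq_sym => /negbTE ->.
Qed.

Lemma inspanD u v : inspan u -> inspan v -> inspan (fun x => u x + v x).
Proof.
move=> [l1 ->] [l2 ->]; exists (l1 ++ l2).
by apply/funext => x; rewrite big_cat.
Qed.

Lemma inspanZ (c : R) u : inspan u -> inspan (fun x => c * u x).
Proof.
move=> [l ->]; exists [seq (c * p.1, p.2) | p <- l].
apply/funext => x; rewrite big_map mulr_sumr.
by apply: eq_bigr => p _; rewrite mulrA.
Qed.

Lemma inspan_e i : inspan (e i).
Proof.
by exists [:: (1, i)]; apply/funext => x; rewrite big_seq1 mul1r.
Qed.

Lemma L2_inspan u : inspan u -> L2 u.
Proof. by move=> /inspan_lincomb[s [c [_ ->]]]; exact: L2_lincomb. Qed.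

(** Membership in the L2(D)-closure of the span of the family. *)
Definition approximable u := forall eps : R, 0 < eps ->
  exists2 v, inspan v & dot (fun x => u x - v x) (fun x => u x - v x) < eps.

Lemma approximable_inspan u : inspan u -> approximable u.
Proof.
move=> su eps eps0; exists u => //; rewrite /dot.
under eq_Rintegral do rewrite subrr mulr0.
by rewrite /Rintegral integral0_eq.
Qed.

Lemma eq_approximable u v : (forall x, D x -> u x = v x) ->
  approximable u -> approximable v.
Proof.
move=> uv au eps eps0; have [p sp du] := au eps eps0; exists p => //.
rewrite /dot (@eq_Rintegral _ _ _ mu D (fun x => (u x - p x) * (u x - p x)))//.
by move=> x /set_mem /uv ->.
Qed.

Lemma approximableD u v : L2 u -> L2 v -> approximable u -> approximable v ->
  approximable (fun x => u x + v x).
Proof.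
move=> Lu Lv au av eps eps0.
have [u' su' du] := au (eps / 4) ltac:(by rewrite divr_gt0).
have [v' sv' dv] := av (eps / 4) ltac:(by rewrite divr_gt0).
exists (fun x => u' x + v' x); first exact: inspanD.
have := dotD_le mD (L2B mD Lu (L2_inspan su')) (L2B mD Lv (L2_inspan sv')).
rewrite (_ : (fun x => u x - u' x + (v x - v' x)) =
  (fun x => u x + v x - (u' x + v' x))); last by apply/funext => x; ring.
by move=> /le_lt_trans; apply; lra.
Qed.

Lemma approximableZ (c : R) u : L2 u -> approximable u -> approximable (fun x => c * u x).
Proof.
move=> Lu au eps eps0.
have [|u' su' du] := au (eps / (c ^+ 2 + 1)).
  by rewrite divr_gt0// ltr_wpDl ?sqr_ge0.
exists (fun x => c * u' x); first exact: inspanZ.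
have Ld := L2B mD Lu (L2_inspan su').
rewrite (_ : (fun x => _ - _) = (fun x => c * (u x - u' x))); last first.
  by apply/funext => x; ring.
rewrite dotZl//; last exact: L2Z.
rewrite dotC dotZl//; move: du; rewrite ltr_pdivlMr ?ltr_wpDl ?sqr_ge0//.
have := dot_ge0 mu D (fun x => u x - u' x); nra.
Qed.

Lemma approximable_closed u : L2 u ->
  (forall eps, 0 < eps -> exists v, [/\ L2 v, approximable v &
    dot (fun x => u x - v x) (fun x => u x - v x) < eps]) ->
  approximable u.
Proof.
move=> Lu h eps eps0.
have [v [Lv av dv]] := h (eps / 4) ltac:(by rewrite divr_gt0).
have [w sw dw] := av (eps / 4) ltac:(by rewrite divr_gt0).
exists w => //.
have := dotD_le mD (L2B mD Lu Lv) (L2B mD Lv (L2_inspan sw)).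
under [X in dot X X]eq_fun do rewrite addrA subrK.
by move=> /le_lt_trans; apply; lra.
Qed.

(** Upper bound: Bessel. Lower bound: an element of the span at squared
    distance less than [eps / L] from [u] is no closer than the Fourier partial
    sum over the same indices, whose squared distance is the defect in Bessel's
    inequality. *)
Lemma approximable_parseval u : L2 u -> approximable u ->
  (\esum_(i in [set: I]) ((dot u (e i)) ^+ 2)%:E = (L * dot u u)%:E)%E.
Proof.
move=> Lu au; apply/eqP; rewrite eq_le; apply/andP; split.
  apply: ge_ereal_sup => _ [A [finA _] <-].
  rewrite fsbig_finite//= sumEFin lee_fin; exact: bessel.
apply/lee_addgt0Pr => eps eps0.
have [|v /inspan_lincomb[s [c [us ->]]] dv] := au (eps / L).
  by rewrite divr_gt0.
rewrite -leeBlDr// -EFinB.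
apply: esum_ge; exists [set` s].
  by split => //; exact: finite_seq.
rewrite -fsbig_seq//= sumEFin lee_fin.
move: dv; rewrite dot_sub_lincomb// ltr_pdivlMr// => dv.
have : 0 <= \sum_(i <- s) (dot u (e i) - L * c i) ^+ 2.
  by apply: sumr_ge0 => i _; exact: sqr_ge0.
move: dv; set a := dot u u; set b := \sum_(_ <- _) _; set b' := \sum_(_ <- _) _.
have -> : (a - L^-1 * b + L^-1 * b') * L = L * a - b + b'.
  by field; rewrite gt_eqF.
lra.
Qed.

End OrthogonalFamily.

(** * Density from a generating pi-system *)

Section Density.
Context d (T : measurableType d) (R : realType).
Variables (mu : {measure set T -> \bar R}) (D : set T).
Hypothesis mD : measurable D.
Hypothesis finD : (mu D < +oo)%E.
Local Notation L2 := (L2 mu D).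
Local Notation dot := (dot mu D).
Variables (I : choiceType) (e : I -> T -> R).
Hypothesis L2e : forall i, L2 (e i).
Local Notation approximable := (approximable mu D e).
Implicit Types (u v w : T -> R).

Lemma L2_bounded u (M : R) : measurable_fun D u ->
  (forall x, D x -> `|u x| <= M) -> L2 u.
Proof.
move=> mu_ uM; split => //.
apply: measurable_bounded_integrable => //; first exact: measurable_funX.
exists (M ^+ 2); split => [|N MN x Dx]; first exact: num_real.
rewrite /= normrX (le_trans _ (ltW MN))//.
by rewrite ler_sqr ?nnegrE// ?uM// (le_trans _ (uM _ Dx)).
Qed.

Lemma L2_indic (A : set T) : measurable A -> L2 \1_A.
Proof.
move=> mA; apply: (@L2_bounded _ 1).
  exact: measurable_indic.
by move=> x _; rewrite ger0_norm// indicE lern1 leq_b1.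
Qed.

(** Dominated convergence applied to [(u - u_ n)^2]. *)
Lemma approximable_dominated (u_ : nat -> T -> R) u (g : T -> R) :
  (forall n, L2 (u_ n)) -> (forall n, approximable (u_ n)) -> L2 u ->
  mu.-integrable D (EFin \o g) ->
  (forall n x, D x -> (u x - u_ n x) ^+ 2 <= g x) ->
  (forall x, D x -> u_ n x @[n --> \oo] --> u x) ->
  approximable u.
Proof.
move=> Lu_ au_ Lu ig ug uu; apply: (approximable_closed mD L2e) => // eps eps0.
pose f_ n x := ((u x - u_ n x) ^+ 2)%:E.
have mf_ n : measurable_fun D (f_ n).
  apply/measurable_EFinP; apply: measurable_funX.
  exact: measurable_funB Lu.1 (Lu_ n).1.
have f0 x : D x -> f_ n x @[n --> \oo] --> (0 : \bar R)%E.
  move=> Dx; apply: cvg_EFin; first exact: nearW.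
  have : (u x - u_ n x) ^+ 2 @[n --> \oo] --> (u x - u x) ^+ 2.
    have h : u x - u_ n x @[n --> \oo] --> u x - u x.
      by apply: cvgB; [exact: cvg_cst|exact: uu].
    rewrite expr2; under eq_fun do rewrite expr2.
    exact: cvgM.
  by rewrite subrr expr0n.
have fg n x : D x -> (`|f_ n x| <= (g x)%:E)%E.
  by move=> Dx; rewrite /f_ /= lee_fin ger0_norm ?sqr_ge0// ug.
have fing x : D x -> (EFin \o g) x \is a fin_num by [].
have := dominated_cvg mD mf_ f0 fing ig fg.
rewrite integral0 => /fine_cvgP[_ h].
have /cvgrPdist_lt/(_ _ eps0)[N _ /(_ N (leqnn N))] := h.
rewrite sub0r normrN => hN.
exists (u_ N); split => //.
apply: le_lt_trans hN; apply: le_trans (ler_norm _).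
rewrite le_eqVlt; apply/orP; left.
by apply/eqP; congr fine; apply: eq_integral => x _; rewrite /f_ expr2.
Qed.

Hypothesis approximable1 : approximable (fun=> 1).

Lemma approximable_setC (A : set T) : measurable A ->
  approximable \1_A -> approximable \1_(~` A).
Proof.
move=> mA aA.
have L1 : L2 (fun=> 1) by apply: (@L2_bounded _ 1) => // x _; rewrite normr1.
have := approximableD mD L2e L1 (L2Z mD (-1) (L2_indic mA)) approximable1
  (approximableZ mD L2e (-1) (L2_indic mA) aA).
congr (approximable _); apply/funext => x; rewrite !indicE in_setC.
by case: (x \in A) => /=; ring.
Qed.

Lemma approximable_setU (A B : set T) : measurable A -> measurable B ->
  A `&` B = set0 -> approximable \1_A -> approximable \1_B ->
  approximable \1_(A `|` B).
Proof.
move=> mA mB AB aA aB.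
have := approximableD mD L2e (L2_indic mA) (L2_indic mB) aA aB.
congr (approximable _); apply/funext => x; rewrite !indicE in_setU.
have : x \notin A `&` B by rewrite AB in_set0.
by rewrite in_setI; case: (x \in A); case: (x \in B) => //=; rewrite ?addr0 ?add0r.
Qed.

(** Countable additivity, by dominated convergence along finite unions; the
    constant 1 dominates because [D] has finite measure. *)
Lemma approximable_bigcup (F : (set T)^nat) : (forall n, measurable (F n)) ->
  trivIset [set: nat] F -> (forall n, approximable \1_(F n)) ->
  approximable \1_(\bigcup_k F k).
Proof.
move=> mF tF aF.
have mU n : measurable (\big[setU/set0]_(k < n) F k).
  exact: bigsetU_measurable.
have aU n : approximable \1_(\big[setU/set0]_(k < n) F k).
  elim: n => [|n IH].
    rewrite big_ord0 indic0; apply: approximable_inspan.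
    by exists [::]; apply/funext => x; rewrite big_nil.
  rewrite big_ord_recr/=; apply: (approximable_setU (mU n) (mF n) _ IH (aF n)).
  by apply: (trivIset_bigsetUI (D := predT)) => //; rewrite /predT /= trueE.
have mUF : measurable (\bigcup_k F k) by exact: bigcupT_measurable.
apply: (@approximable_dominated
  (fun n => \1_(\big[setU/set0]_(k < n) F k)) _ (fun=> 1)) => //.
- by move=> n; exact: L2_indic.
- exact: L2_indic.
- have [_] : L2 (fun=> 1) by apply: (@L2_bounded _ 1) => // x _; rewrite normr1.
  by congr (integrable _ _ _); apply/funext => x /=; rewrite expr1n.
- move=> x _; apply: cvg_near_cst; have [[k _ Fk]|nF] := pselect ((\bigcup_k F k) x).
    exists k.+1 => // n /= kn; rewrite !indicE !mem_set//; first by exists k.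
    by rewrite -bigcup_mkord; exists k.
  apply: nearW => n; rewrite !indicE !memNset//.
  by rewrite -bigcup_mkord => -[k _ Fk]; apply: nF; exists k.
Qed.

Variable G : set (set T).
Hypothesis GE : @measurable _ T = <<s G >>.
Hypothesis GI : setI_closed G.
Hypothesis aG : forall A, G A -> approximable \1_A.

(** Sets with approximable indicator form a Dynkin system, so a generating
    pi-system suffices. *)
Lemma approximable_indic (A : set T) : measurable A -> approximable \1_A.
Proof.
rewrite GE; move: A.
apply: (dynkin_induction (P := fun A => approximable \1_A) GE GI) => //.
- by rewrite indicT.
- exact: approximable_setC.
- exact: approximable_bigcup.
Qed.

Import HBNNSimple.
Lemma approximable_sfun (f : {nnsfun T >-> R}) : L2 f /\ approximable f.
Proof.
have -> : (f : T -> R) = fun x =>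
    \sum_(y <- finmap.enum_fset (fset_set (range f))) (y * \1_(f @^-1` [set y]) x).
  by apply/funext => x; rewrite fimfunE fsbig_finite.
elim: (finmap.enum_fset (fset_set (range f))) => [|y s [IHL IHa]].
  under eq_fun do rewrite big_nil; split.
    exact: L2_0.
  by apply: approximable_inspan; exists [::]; apply/funext => x; rewrite big_nil.
under eq_fun do rewrite big_cons.
have mA : measurable (f @^-1` [set y]) by exact: measurable_sfunP.
have LA := L2_indic mA.
split; first by apply: L2D => //; exact: L2Z.
apply: approximableD => //; first exact: L2Z.
by apply: approximableZ => //; exact: approximable_indic.
Qed.

(** The simple functions increasing to [u] satisfy [(u - f n)^2 <= u^2]. *)
Lemma approximable_nonneg u : L2 u -> (forall x, D x -> 0 <= u x) -> approximable u.
Proof.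
move=> Lu u0.
have mu_ : measurable_fun D (EFin \o u) by apply/measurable_EFinP; exact: Lu.1.
pose f n := nnsfun_approx mD mu_ n.
have fcvg x : D x -> (EFin \o f ^~ x) @ \oo --> (u x)%:E.
  by move=> Dx; apply: (@cvg_nnsfun_approx _ _ _ _ mD _ mu_) => // y Dy; rewrite lee_fin u0.
have fcvgr x : D x -> f n x @[n --> \oo] --> u x.
  by move=> /fcvg /fine_cvgP[].
have fle n x : D x -> f n x <= u x.
  move=> Dx; have := fcvgr x Dx => /cvg_lim <- //.
  apply: (nondecreasing_cvgn_le (u_ := fun n => f n x)).
    by move=> i j ij; have /lefP := nd_nnsfun_approx mD mu_ ij; exact.
  by apply/cvg_ex; exists (u x); exact: fcvgr.
apply: (@approximable_dominated f u (fun x => u x ^+ 2)) => //.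
- by move=> n; have [] := approximable_sfun (f n).
- by move=> n; have [] := approximable_sfun (f n).
- by case: Lu.
- move=> n x Dx; have := fle n x Dx; have : 0 <= f n x by [].
  have := u0 x Dx; nra.
Qed.

Lemma approximable_all u : L2 u -> approximable u.
Proof.
move=> Lu.
have Lp v : L2 v -> L2 (fun x => Num.max (v x) 0).
  move=> [mv iv]; split; first exact: measurable_maxr.
  apply: le_integrable iv => //.
    by apply/measurable_EFinP/measurable_funX; exact: measurable_maxr.
  move=> x Dx /=; rewrite lee_fin !ger0_norm ?sqr_ge0//.
  by case: (ltP (v x) 0) => // _; rewrite expr0n sqr_ge0.
have LN := L2Z mD (-1) Lu.
have aP : approximable (fun x => Num.max (u x) 0).
  by apply: approximable_nonneg => [|x _]; [exact: Lp|rewrite le_max lexx orbT].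
have aN : approximable (fun x => Num.max (-1 * u x) 0).
  by apply: approximable_nonneg => [|x _]; [exact: Lp|rewrite le_max lexx orbT].
have := approximableD mD L2e (Lp _ Lu) (L2Z mD (-1) (Lp _ LN)) aP
  (approximableZ mD L2e (-1) (Lp _ LN) aN).
congr (approximable _); apply/funext => x.
by case: (ltP (u x) 0); case: (ltP (-1 * u x) 0); lra.
Qed.

End Density.

(** * The real trigonometric system *)

Section Trigonometry.
Context {R : realType}.
Notation mu := (@lebesgue_measure R).
Implicit Types (t x : R) (k m n : int).

Lemma cosDint x k : cos (x + k%:~R * (2 * pi)) = cos x.
Proof.
have nat_case (y : R) (j : nat) : cos (y + j%:R * (2 * pi)) = cos y.
  by rewrite mulr_natl mulr_natl periodicn//; exact: cosD2pi.
case: k => j; first exact: nat_case.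
by rewrite NegzE mulrNz mulNr -[LHS](nat_case _ j.+1) subrK.
Qed.

Lemma sinDint x k : sin (x + k%:~R * (2 * pi)) = sin x.
Proof.
have nat_case (y : R) (j : nat) : sin (y + j%:R * (2 * pi)) = sin y.
  by rewrite mulr_natl mulr_natl periodicn//; exact: sinD2pi.
case: k => j; first exact: nat_case.
by rewrite NegzE mulrNz mulNr -[LHS](nat_case _ j.+1) subrK.
Qed.

Lemma continuous_integrable_itv (f : R -> R) a c b1 b2 : continuous f ->
  mu.-integrable [set` Interval (BSide b1 a) (BSide b2 c)] (EFin \o f).
Proof.
move=> cf; apply: (@integrableS _ _ _ mu `[a, c]) => //.
  by apply: subset_itvScc; rewrite ?bnd_simp; [case: b1|case: b2].
apply: continuous_compact_integrable; first exact: segment_compact.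
exact: continuous_subspaceT.
Qed.

Lemma Rintegral_oo_cc (f : R -> R) a c : continuous f ->
  \int[mu]_(t in `]a, c[) f t = \int[mu]_(t in `[a, c]) f t.
Proof.
move=> cf; rewrite Rintegral_itv_obnd_cbnd ?Rintegral_itv_bndo_bndc//.
  exact: continuous_integrable_itv.
exact: continuous_integrable_itv.
Qed.

Lemma Rintegral_derive (f F : R -> R) a c : a < c -> continuous f ->
  (forall t, is_derive t 1 F (f t)) ->
  \int[mu]_(t in `]a, c[) f t = F c - F a.
Proof.
move=> ac cf dF; rewrite Rintegral_oo_cc//.
have cF : continuous F.
  by move=> t; apply/differentiable_continuous/derivable1_diffP; case: (dF t).
have := continuous_FTC2 (F := F) ac (continuous_subspaceT cf).
rewrite /Rintegral => -> //.
  split => [t _||]; first by case: (dF t).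
    by apply: cvg_at_right_filter; exact: cF.
  by apply: cvg_at_left_filter; exact: cF.
by move=> t _; rewrite derive1E; case: (dF t).
Qed.

Lemma continuous_cosM (r : R) : continuous (fun t => cos (r * t)).
Proof.
move=> t; apply: continuous_comp; last exact: continuous_cos.
by apply: cvgMr; exact: cvg_id.
Qed.

Lemma continuous_sinM (r : R) : continuous (fun t => sin (r * t)).
Proof.
move=> t; apply: continuous_comp; last exact: continuous_sin.
by apply: cvgMr; exact: cvg_id.
Qed.

Variables (b L : R).
Hypothesis L0 : 0 < L.
Notation w := (2 * pi / L).

Lemma int_cos_period k : \int[mu]_(t in `]b, b + L[) cos (k%:~R * w * t) = L * (k == 0)%:R.
Proof.
have bL : b < b + L by rewrite ltrDl.
have cc : continuous (fun t : R => cos (k%:~R * w * t)).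
  exact: continuous_cosM.
have [k0|k0] := eqVneq k 0.
  have dF t : is_derive t 1 id (cos (k%:~R * w * t)).
    by rewrite k0 !mul0r cos0; exact: is_derive_id.
  by rewrite (Rintegral_derive bL cc dF) mulr1 addrC addKr.
have pi0 : (pi : R) != 0 by rewrite gt_eqF// pi_gt0.
have L1 : L != 0 by rewrite gt_eqF.
have kR : k%:~R != 0 :> R by rewrite intr_eq0.
have kw0 : k%:~R * w != 0 by rewrite !mulf_neq0 ?invr_eq0.
have dF t : is_derive t 1 (fun t => (k%:~R * w)^-1 * sin (k%:~R * w * t))
    (cos (k%:~R * w * t)).
  apply: is_derive_eq; rewrite /GRing.scale/=.
  by move: (k%:~R * w) kw0 => r r0; field.
rewrite (Rintegral_derive bL cc dF) (_ : _ * (b + L) = k%:~R * w * b + k%:~R * (2 * pi)).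
  by rewrite sinDint subrr mulr0.
by move: (pi : R) => p; field.
Qed.

Lemma int_sin_period k : \int[mu]_(t in `]b, b + L[) sin (k%:~R * w * t) = 0.
Proof.
have bL : b < b + L by rewrite ltrDl.
have cc : continuous (fun t : R => sin (k%:~R * w * t)).
  exact: continuous_sinM.
have [k0|k0] := eqVneq k 0.
  have dF t : is_derive t 1 (fun=> 0) (sin (k%:~R * w * t)).
    by rewrite k0 !mul0r sin0; exact: is_derive_cst.
  by rewrite (Rintegral_derive bL cc dF) subrr.
have pi0 : (pi : R) != 0 by rewrite gt_eqF// pi_gt0.
have L1 : L != 0 by rewrite gt_eqF.
have kR : k%:~R != 0 :> R by rewrite intr_eq0.
have kw0 : k%:~R * w != 0 by rewrite !mulf_neq0 ?invr_eq0.
have dF t : is_derive t 1 (fun t => - (k%:~R * w)^-1 * cos (k%:~R * w * t))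
    (sin (k%:~R * w * t)).
  apply: is_derive_eq; rewrite /GRing.scale/=.
  by move: (k%:~R * w) kw0 => r r0; field.
rewrite (Rintegral_derive bL cc dF) (_ : _ * (b + L) = k%:~R * w * b + k%:~R * (2 * pi)).
  by rewrite cosDint subrr.
by move: (pi : R) => p; field.
Qed.

(** Hartley's function cos + sin. Indexing by all integers with this
    single real orthogonal family, all of the same norm, replaces the usual
    constants, cosines and sines with their separate normalizations; cosines and
    sines are its even and odd parts in [n]. *)
Definition cas n t := cos (n%:~R * w * t) + sin (n%:~R * w * t).

(** The product formula behind both the orthogonality relations and the fact
    that trigonometric polynomials form an algebra. *)
Lemma cas_mul m n t :
  cas m t * cas n t = cos ((m - n)%:~R * w * t) + sin ((m + n)%:~R * w * t).
Proof.
rewrite /cas rmorphB rmorphD/= !mulrBl !mulrDl cosB sinD; ring.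
Qed.

Notation D := (`]b, b + L[%classic : set R).

Lemma continuous_cas n : continuous (cas n).
Proof.
move=> t; apply: cvgD.
  exact: continuous_cosM.
exact: continuous_sinM.
Qed.

Lemma period_finite : (mu D < +oo)%E.
Proof. by rewrite lebesgue_measure_itv/=; case: ifP => _; rewrite -?EFinB ltry. Qed.

Lemma L2_cas n : L2 mu D (cas n).
Proof.
apply: (@L2_bounded _ _ _ mu D _ period_finite _ 2) => //.
- by apply: measurable_funS (continuous_measurable_fun (@continuous_cas n)).
- move=> t _; rewrite (le_trans (ler_normD _ _))//.
  by have := cos_max (n%:~R * w * t); have := sin_max (n%:~R * w * t); lra.
Qed.

Lemma cas_orth m n : dot mu D (cas m) (cas n) = L * (m == n)%:R.
Proof.
rewrite /dot; under eq_Rintegral do rewrite cas_mul.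
rewrite RintegralD//.
- by rewrite int_cos_period int_sin_period addr0 subr_eq0.
- apply: continuous_integrable_itv.
  exact: continuous_cosM.
- apply: continuous_integrable_itv.
  exact: continuous_sinM.
Qed.

Notation inspan := (@inspan _ _ cas).

End Trigonometry.

(** * Density of trigonometric polynomials *)

Section FourierParseval.
Context {R : realType}.
Notation mu := (@lebesgue_measure R).

Lemma bernoulli_ge (z : R) (k : nat) : 0 <= z <= 1 -> 1 - k%:R * z <= (1 - z) ^+ k.
Proof.
move=> /andP[z0 z1]; elim: k => [|k IH]; first by rewrite mul0r subr0 expr0.
rewrite exprS -natr1.
have : (1 - z) * (1 - k%:R * z) <= (1 - z) * (1 - z) ^+ k.
  by rewrite ler_wpM2l// subr_ge0.
have : 0 <= k%:R * z ^+ 2 by rewrite mulr_ge0// sqr_ge0.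
by nra.
Qed.

Lemma pow1B_le_expR (z : R) (k : nat) : 0 <= z <= 1 ->
  (1 - z) ^+ k <= expR (- (k%:R * z)).
Proof.
move=> /andP[z0 z1]; rewrite -mulrN expRM_natl.
by rewrite lerXn2r ?nnegrE ?expR_ge0 ?subr_ge0//; have := expR_ge1Dx (- z).
Qed.

(** With [y] halfway between [x] and 1, [n y^n] is bounded by [1 / (1 - y)],
    so [n x^n] is at most a constant times [(x / y)^n]. *)
Lemma cvg_nexpr (x : R) : 0 <= x < 1 -> n%:R * x ^+ n @[n --> \oo] --> 0.
Proof.
move=> /andP[x0 x1]; pose y := (x + 1) / 2.
have y01 : 0 < y < 1 by rewrite /y; apply/andP; split; lra.
have /andP[y0 y1] := y01.
have xy : `|x / y| < 1.
  have xy0 : 0 <= x / y by rewrite divr_ge0// ltW.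
  by rewrite (ger0_norm xy0) ltr_pdivrMr// mul1r /y; lra.
have b n : n%:R * y ^+ n <= (1 - y)^-1.
  rewrite -[leRHS]mul1r ler_pdivlMr ?subr_gt0//.
  suff : n%:R * y ^+ n * (1 - y) <= 1 - y ^+ n.
    by move/le_trans; apply; rewrite gerBl exprn_ge0// ltW.
  elim: n => [|n IH]; first by rewrite mul0r mul0r expr0 subrr.
  rewrite -natr1 exprS; have : y ^+ n <= 1 by rewrite exprn_ile1// ltW.
  have := ler_wpM2l (ltW y0) IH.
  move: (n%:R : R) (y ^+ n) => N Y yIH Y1.
  have : 0 <= (1 - y) * (1 - y * Y) by rewrite mulr_ge0; nra.
  lra.
apply: (@squeeze_cvgr _ _ _ _ (fun=> 0) (fun n => (1 - y)^-1 * (x / y) ^+ n)).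
- near=> n; apply/andP; split; first by rewrite mulr_ge0// exprn_ge0.
  rewrite (_ : n%:R * x ^+ n = n%:R * y ^+ n * (x / y) ^+ n); last first.
    by rewrite -mulrA -exprMn [y * _]mulrC divfK ?gt_eqF.
  by rewrite ler_wpM2r// exprn_ge0// divr_ge0// ltW.
- exact: cvg_cst.
- rewrite -[X in _ --> X](mulr0 (1 - y)^-1); apply: cvgMr; exact: cvg_expr.
Unshelve. all: by end_near. Qed.

(** Polynomials that converge boundedly to the indicator of [q < 1/2] on the
    unit interval. The exponent [n 2^n] turns [q^n] into [n (2 q)^n], which tends
    to 0 below the threshold and to infinity from the threshold on; the factor
    [n] decides the case [q = 1/2]. *)
Lemma threshold_cvg (q : R) : 0 <= q <= 1 ->
  (1 - q ^+ n) ^+ (n * 2 ^ n) @[n --> \oo] --> ((q < 2^-1)%R%:R : R).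
Proof.
move=> /andP[q0 q1].
have q01 n : 0 <= q ^+ n <= 1 by rewrite exprn_ge0//= exprn_ile1.
have E n : (n * 2 ^ n)%:R * q ^+ n = n%:R * (2 * q) ^+ n.
  by rewrite natrM natrX exprMn mulrA.
case: ltP => q2 /=.
  apply: (@squeeze_cvgr _ _ _ _ (fun n => 1 - n%:R * (2 * q) ^+ n) (fun=> 1)).
  - near=> n; rewrite -E bernoulli_ge//=.
    by have /andP[? ?] := q01 n; rewrite exprn_ile1// ?subr_ge0// gerBl.
  - rewrite -[X in _ --> X]subr0; apply: cvgB; first exact: cvg_cst.
    by apply: cvg_nexpr; apply/andP; split; lra.
  - exact: cvg_cst.
apply: (@squeeze_cvgr _ _ _ _ (fun=> 0) (fun n => expR (- n%:R))).
- near=> n; have /andP[? ?] := q01 n.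
  rewrite exprn_ge0 ?subr_ge0//= (le_trans (pow1B_le_expR _ (q01 n)))//.
  rewrite ler_expR lerN2 E ler_peMr// exprn_ege1//; lra.
- exact: cvg_cst.
- exact: cvgn_expR.
Unshelve. all: by end_near. Qed.

Variables (b L : R).
Hypothesis L0 : 0 < L.
Notation w := (2 * pi / L).
Notation D := (`]b, b + L[%classic : set R).
Notation inspan := (inspan (cas L)).
Implicit Types (t : R) (u v : R -> R).

Let cas0 : cas L 0 = fun=> 1.
Proof. by apply/funext => t; rewrite /cas !mul0r cos0 sin0 addr0. Qed.

Lemma inspan_cst c : inspan (fun=> c).
Proof.
have := inspanZ c (inspan_e (cas L) 0).
by rewrite cas0; under eq_fun do rewrite mulr1.
Qed.

Lemma inspan_cos n : inspan (fun t => cos (n%:~R * w * t)).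
Proof.
have := inspanZ 2^-1 (inspanD (inspan_e (cas L) n) (inspan_e (cas L) (- n))).
congr (inspan _); apply/funext => t; rewrite /cas mulrNz !mulNr cosN sinN; lra.
Qed.

Lemma inspan_sin n : inspan (fun t => sin (n%:~R * w * t)).
Proof.
have := inspanZ 2^-1 (inspanD (inspan_e (cas L) n)
  (inspanZ (-1) (inspan_e (cas L) (- n)))).
congr (inspan _); apply/funext => t; rewrite /cas mulrNz !mulNr cosN sinN; lra.
Qed.

Lemma inspan_sum (A : Type) (s : seq A) (F : A -> R -> R) :
  (forall i, inspan (F i)) -> inspan (fun t => \sum_(i <- s) F i t).
Proof.
move=> sF; elim: s => [|i s IH].
  by under eq_fun do rewrite big_nil; exact: inspan_cst.
by under eq_fun do rewrite big_cons; exact: inspanD.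
Qed.

Lemma inspanM u v : inspan u -> inspan v -> inspan (fun t => u t * v t).
Proof.
move=> [l1 ->] [l2 ->]; under eq_fun do rewrite mulr_suml.
apply: inspan_sum => p; under eq_fun do rewrite mulr_sumr.
apply: inspan_sum => q; under eq_fun do rewrite mulrACA cas_mul.
by apply/inspanZ/inspanD; [exact: inspan_cos|exact: inspan_sin].
Qed.

Lemma inspanX u n : inspan u -> inspan (fun t => u t ^+ n).
Proof.
move=> su; elim: n => [|n IH].
  by under eq_fun do rewrite expr0; exact: inspan_cst.
by under eq_fun do rewrite exprS; exact: inspanM.
Qed.

(** For [y] in [D], the ray is, within [D], the set where a trigonometric
    polynomial [q] with values in the unit interval is below 1/2, and
    [threshold_cvg] then produces trigonometric polynomials converging boundedly
    to its indicator. The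
    polynomial comes from [cos (X - Y) - cos (X + Y) = 2 sin X sin Y] with
    [X = pi (t - b) / L] and [Y = pi (y - t) / L]: on [D], [sin X > 0], and
    [sin Y] has the sign of [y - t]. *)
Lemma approximable_ray y : approximable mu D (cas L) \1_(`]-oo, y[).
Proof.
have L2e := L2_cas b L.
have fD := period_finite b L.
have LI : L2 mu D \1_(`]-oo, y[) by apply: (L2_indic _ fD).
pose c := (b + y) / 2; pose r := (y - b) / 2.
(* The factor 1/4 keeps [q] in the unit interval. *)
pose q t := 2^-1 - 4^-1 * (cos (w * (t - c)) - cos (w * r)).
have sq : inspan q.
  have := inspanD (inspan_cst (2^-1 + 4^-1 * cos (w * r)))
    (inspanD (inspanZ (- 4^-1 * cos (w * c)) (inspan_cos 1))
      (inspanZ (- 4^-1 * sin (w * c)) (inspan_sin 1))).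
  congr (inspan _); apply/funext => t; rewrite /q [w * (t - c)]mulrBr cosB !mul1r; ring.
have q01 t : 0 <= q t <= 1.
  have := cos_geN1 (w * (t - c)); have := cos_le1 (w * (t - c)).
  have := cos_geN1 (w * r); have := cos_le1 (w * r).
  by rewrite /q => *; apply/andP; split; lra.
have [yb|yb] := leP y b.
  apply: (eq_approximable (u := fun=> 0)); last first.
    exact/approximable_inspan/inspan_cst.
  move=> t; rewrite /= in_itv/= => /andP[bt _]; rewrite indicE memNset//=.
  by rewrite in_itv/=; apply/negP; rewrite -leNgt (le_trans yb)// ltW.
have [yL|yL] := leP (b + L) y.
  apply: (eq_approximable (u := fun=> 1)); last first.
    exact/approximable_inspan/inspan_cst.
  move=> t; rewrite /= in_itv/= => /andP[_ bt]; rewrite indicE mem_set//=.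
  by rewrite in_itv/= (lt_le_trans bt).
have pi0 : 0 < pi :> R by exact: pi_gt0.
have qy t : D t -> (q t < 2^-1) = (t < y).
  rewrite /= in_itv/= => /andP[bt tL].
  pose X := pi * ((t - b) / L); pose Y := pi * ((y - t) / L).
  have X0 : 0 < sin X.
    apply: sin_gt0_pi; rewrite /X mulr_gt0//= ?divr_gt0 ?subr_gt0//.
    by rewrite gtr_pMr// ltr_pdivrMr// mul1r ltrBlDl.
  have EX : w * (t - c) = X - Y.
    by rewrite /X /Y /c; move: (pi : R) => p; field; rewrite gt_eqF.
  have EY : w * r = X + Y.
    by rewrite /X /Y /r; move: (pi : R) => p; field; rewrite gt_eqF.
  have -> : (q t < 2^-1) = (0 < sin X * sin Y).
    by rewrite /q EX EY cosB cosD; apply/idP/idP => h; lra.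
  rewrite pmulr_rgt0//; case: (ltgtP t y) => ty.
  - apply: sin_gt0_pi; rewrite /Y mulr_gt0//= ?divr_gt0 ?subr_gt0//.
    by rewrite gtr_pMr// ltr_pdivrMr// mul1r; lra.
  - apply/negbTE; rewrite -leNgt -oppr_ge0 -sinN; apply: sin_ge0_pi.
    rewrite /Y -mulrN -mulNr opprB mulr_ge0 ?divr_ge0 ?subr_ge0 ?ltW//=.
    by rewrite gtr_pMr// ltr_pdivrMr// mul1r; lra.
  - by rewrite /Y ty subrr mul0r mulr0 sin0 ltxx.
pose p n t := (1 - q t ^+ n) ^+ (n * 2 ^ n).
have sp n : inspan (p n).
  apply: inspanX; apply: inspanD; first exact: inspan_cst.
  have := inspanZ (-1) (inspanX n sq).
  by under eq_fun do rewrite mulN1r.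
have p01 n t : 0 <= p n t <= 1.
  have /andP[q0 q1] := q01 t.
  have : 0 <= 1 - q t ^+ n <= 1.
    by rewrite subr_ge0 gerBl exprn_ile1//= exprn_ge0.
  by move=> /andP[? ?]; rewrite exprn_ge0//= exprn_ile1.
apply: (approximable_dominated _ L2e (u_ := p) (g := fun=> 1)) => //.
- by move=> n; apply: (L2_inspan _ L2e (sp n)).
- by move=> n; exact/approximable_inspan/sp.
- have [_] : L2 mu D (fun=> 1).
    by apply: (L2_bounded _ fD (M := 1)) => // x _; rewrite normr1.
  by congr (integrable _ _ _); apply/funext => x /=; rewrite expr1n.
- move=> n t _; have /andP[p0 p1] := p01 n t.
  have [] : 0 <= (\1_(`]-oo, y[) t : R) <= 1 by rewrite indicE ler0n lern1 leq_b1.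
  by move=> /andP[? ?]; nra.
- move=> t Dt; rewrite indicE.
  have -> : (t \in (`]-oo, y[%classic : set R)) = (q t < 2^-1).
    by rewrite qy//; apply/idP/idP => [/set_mem|ty]; [|apply/mem_set]; rewrite /= in_itv.
  exact: threshold_cvg.
Qed.

(** Parseval's identity on an interval of length [L], for real functions. *)
Lemma fourier_parseval u : L2 mu D u ->
  (\esum_(n in [set: int]) ((dot mu D u (cas L n)) ^+ 2)%:E
   = (L * dot mu D u u)%:E)%E.
Proof.
move=> Lu; apply: approximable_parseval => //.
- exact: L2_cas.
- exact: cas_orth.
- apply: (approximable_all _ (period_finite b L) (L2_cas b L) _
    (RGenInftyO.measurableE R)) => //.
  + exact/approximable_inspan/inspan_cst.
  + move=> A B [x ->] [y ->]; exists (Num.min x y).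
    apply/seteqP; split => z /=; rewrite !in_itv/= lt_min; last by move=> /andP.
    by move=> [-> ->].
  + by move=> A [y ->]; exact: approximable_ray.
Qed.

End FourierParseval.

(** * Smooth functions of a real variable *)

Section SmoothFunctions.
Context {R : realType}.
Implicit Types (f g : R -> R) (t x c : R).

Definition smoothR f := forall n t, derivable (derive1n n f) t 1.

(** A class of functions stable under differentiation consists of smooth
    functions. All smoothness proofs below exhibit such a class, which avoids
    formulas for higher derivatives. *)
Lemma smooth_class (P : (R -> R) -> Prop) :
  (forall f, P f -> exists2 f', P f' & forall t, is_derive t 1 f (f' t)) ->
  forall f, P f -> smoothR f.
Proof.
move=> PD f Pf n; elim: n f Pf => [|n IH] f Pf t.
  by have [f' _ df] := PD f Pf; case: (df t).
rewrite derive1Sn; apply: IH; have [f' Pf' df] := PD f Pf.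
rewrite (_ : (derive1 f) = f')//; apply/funext => x.
by rewrite derive1E; case: (df x).
Qed.

Lemma smooth_derive f : smoothR f ->
  smoothR (derive1 f) /\ forall t, is_derive t 1 f ((derive1 f) t).
Proof.
move=> sf; split => [n t|t]; first by have := sf n.+1 t; rewrite derive1Sn.
by rewrite derive1E; apply: derivableP; exact: (sf 0%N t).
Qed.

Lemma smooth_continuous f : smoothR f -> continuous f.
Proof.
move=> sf t; apply/differentiable_continuous/derivable1_diffP.
exact: (sf 0%N t).
Qed.

(** The functions built from smooth ones by sums, products, composition and
    inversion; closed under differentiation by construction, so that the closure
    properties of smoothness are proved simultaneously. In [SEcomp] the outer
    function is smooth outright, since its derivative must be composable again. *)
Inductive smooth_expr : (R -> R) -> Prop :=
| SEbase f of smoothR f : smooth_expr f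
| SEadd f g of smooth_expr f & smooth_expr g : smooth_expr (fun t => f t + g t)
| SEmul f g of smooth_expr f & smooth_expr g : smooth_expr (fun t => f t * g t)
| SEcomp f g of smoothR f & smooth_expr g : smooth_expr (fun t => f (g t))
| SEinv f of smooth_expr f & (forall t, f t != 0) :
    smooth_expr (fun t => (f t)^-1).

Lemma smooth_cst c : smoothR (fun=> c).
Proof.
apply: (smooth_class (P := fun f => exists c, f = fun=> c)); last by exists c.
by move=> f [k ->]; exists (fun=> 0) => [|t]; [exists 0|exact: is_derive_cst].
Qed.

Lemma smooth_exprP f : smooth_expr f -> smoothR f.
Proof.
apply: smooth_class => {}f; elim => {f}.
- move=> f /smooth_derive[sf' df]; exists (derive1 f) => //; exact: SEbase.
- move=> f g sf [f' sf' df] sg [g' sg' dg].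
  exists (fun t => f' t + g' t); first exact: SEadd.
  by move=> t; exact: (is_deriveD (df t) (dg t)).
- move=> f g sf [f' sf' df] sg [g' sg' dg].
  exists (fun t => f t * g' t + g t * f' t); first by apply: SEadd; exact: SEmul.
  by move=> t; exact: (is_deriveM (df t) (dg t)).
- move=> f g /smooth_derive[sf' df] sg [g' sg' dg].
  exists (fun t => (derive1 f) (g t) * g' t); first by apply: SEmul => //; exact: SEcomp.
  move=> t; exact: (is_derive1_comp (df (g t)) (dg t)).
- move=> f sf [f' sf' df] f0.
  exists (fun t => -1 * ((f t)^-1 * (f t)^-1) * f' t).
    apply: SEmul => //; apply: SEmul; first exact/SEbase/smooth_cst.
    by apply: SEmul; exact: SEinv.
  move=> t; have := is_deriveV (f0 t) (df t); rewrite /GRing.scale/=.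
  by rewrite mulN1r -expr2 exprVn.
Qed.

Lemma smoothD f g : smoothR f -> smoothR g -> smoothR (fun t => f t + g t).
Proof. by move=> ? ?; apply/smooth_exprP/SEadd; exact: SEbase. Qed.

Lemma smoothM f g : smoothR f -> smoothR g -> smoothR (fun t => f t * g t).
Proof. by move=> ? ?; apply/smooth_exprP/SEmul; exact: SEbase. Qed.

Lemma smooth_comp f g : smoothR f -> smoothR g -> smoothR (fun t => f (g t)).
Proof. by move=> ? ?; apply/smooth_exprP/SEcomp => //; exact: SEbase. Qed.

Lemma smoothV f : smoothR f -> (forall t, f t != 0) -> smoothR (fun t => (f t)^-1).
Proof. by move=> ? ?; apply/smooth_exprP/SEinv => //; exact: SEbase. Qed.

Lemma smooth_id : smoothR id.
Proof.
apply: (smooth_class (P := fun f => f = id \/ exists c, f = fun=> c)); last by left.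
move=> f [->|[c ->]].
  by exists (fun=> 1) => [|t]; [right; exists 1|exact: is_derive_id].
by exists (fun=> 0) => [|t]; [right; exists 0|exact: is_derive_cst].
Qed.

Lemma smooth_affine c x : smoothR (fun t => c * t + x).
Proof.
apply: smoothD; last exact: smooth_cst.
by apply: smoothM; [exact: smooth_cst|exact: smooth_id].
Qed.

(** All combinations are considered at once, since sine and cosine are
    exchanged by differentiation. *)
Lemma smooth_trig (c1 c2 : R) : smoothR (fun t => c1 * cos t + c2 * sin t).
Proof.
apply: (smooth_class
  (P := fun f => exists c1 c2, f = fun t => c1 * cos t + c2 * sin t)); last first.
  by exists c1, c2.
move=> _ [k1 [k2 ->]]; exists (fun t => k2 * cos t + (- k1) * sin t) => [|t].
  by exists k2, (- k1).
apply: is_derive_eq; rewrite /GRing.scale/=; ring.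
Qed.

Lemma smooth_cos : smoothR cos.
Proof.
have := @smooth_trig 1 0; congr smoothR.
by apply/funext => t; rewrite mul1r mul0r addr0.
Qed.

Lemma smooth_sin : smoothR sin.
Proof.
have := @smooth_trig 0 1; congr smoothR.
by apply/funext => t; rewrite mul1r mul0r add0r.
Qed.

Lemma poly_le_expR (p : {poly R}) :
  exists2 C, 0 <= C & forall x, 0 <= x -> `|p.[x]| <= C * expR x.
Proof.
have mono n x : 0 <= x -> x ^+ n <= n`!%:R * expR x.
  move=> x0; case: n => [|n].
    by rewrite expr0 fact0 mul1r (le_trans _ (expR_ge1Dx x))// lerDl.
  rewrite mulrC -ler_pdivrMr ?ltr0n ?fact_gt0//.
  by rewrite (le_trans _ (expR_ge1Dxn n x0))// lerDr.
(* Each monomial satisfies [x^i <= i! exp x]. *)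
exists (\sum_(i < size p) `|p`_i| * i`!%:R).
  by apply: sumr_ge0 => i _; rewrite mulr_ge0.
move=> x x0; rewrite horner_coef mulr_suml (le_trans (ler_norm_sum _ _ _))//.
apply: ler_sum => i _; rewrite normrM -mulrA ler_wpM2l//.
by rewrite ger0_norm ?exprn_ge0// mono.
Qed.

(** The functions [p (1 / t) exp (- 1 / t)] extended by 0 to [t <= 0]; for
    varying [p] they form a class stable under differentiation. *)
Definition flat (p : {poly R}) : R -> R :=
  fun t => if 0 < t then p.[t^-1] * expR (- t^-1) else 0.

(** With [x = 1 / t], this is the boundedness of [x^2 p(x) exp (- x)]. *)
Lemma flat_quadratic p : exists2 C, 0 <= C & forall t, `|flat p t| <= C * t ^+ 2.
Proof.
have [C C0 pC] := poly_le_expR (p * 'X^2).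
exists C => // t; rewrite /flat; case: ltP => t0; last first.
  by rewrite normr0 mulr_ge0// sqr_ge0.
have h : `|p.[t^-1]| * t^-1 ^+ 2 <= C * expR t^-1.
  rewrite -[X in _ * X]ger0_norm ?sqr_ge0// -normrM.
  by have := pC t^-1; rewrite invr_ge0 (ltW t0) hornerM hornerXn; exact.
move: h; rewrite exprVn ler_pdivrMr ?exprn_gt0// => h.
rewrite normrM [`|expR _|]ger0_norm ?expR_ge0//.
by rewrite expRN ler_pdivrMr ?expR_gt0// mulrAC.
Qed.

Lemma is_derive0_quadratic f C : (forall t, `|f t| <= C * t ^+ 2) ->
  is_derive (0 : R) 1 f 0.
Proof.
move=> fC; have f0 : f 0 = 0.
  by apply/eqP; rewrite -normr_le0 (le_trans (fC 0))// expr0n mulr0.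
have lim0 : h^-1 *: (f (h *: 1 + 0) - f 0) @[h --> 0^'] --> (0 : R).
  apply/cvgr0Pnorm_le => e e0; near=> h.
  have h0 : h != 0 by near: h; exact: nbhs_dnbhs_neq.
  rewrite f0 subr0 addr0 /GRing.scale/= mulr1 normrM normfV.
  rewrite ler_pdivrMl ?normr_gt0// (le_trans (fC h))//.
  rewrite -real_normK ?num_real// expr2 mulrA mulrC ler_wpM2l//.
  have hd : `|h| <= e / (`|C| + 1).
    near: h; apply: dnbhs0_le; rewrite divr_gt0// ltr_wpDl//.
  move: hd; rewrite ler_pdivlMr ?ltr_wpDl// => hd.
  rewrite (le_trans _ hd)// mulrC ler_wpM2l//.
  by rewrite (le_trans (ler_norm C))// lerDl.
by apply: DeriveDef; [apply/cvg_ex; exists 0|exact: cvg_lim].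
Unshelve. all: by end_near. Qed.

(** Away from 0 this is the product rule; at 0 the quadratic bound
    [flat_quadratic] makes the difference quotient tend to 0. *)
Lemma is_derive_flat p t :
  is_derive t 1 (flat p) (flat ('X^2 * (p - p^`())) t).
Proof.
case: (ltgtP t 0) => t0.
- rewrite [X in is_derive _ _ _ X](_ : _ = 0); last by rewrite /flat ltNge ltW.
  apply: (@near_eq_is_derive _ _ _ (fun=> 0)).
  by near=> x; rewrite /flat ltNge ltW//; near: x; exact: lt_nbhsl.
- rewrite [X in is_derive _ _ _ X](_ : _ =
    p.[t^-1] * ((t ^- 2) * expR (- t^-1)) +
    expR (- t^-1) * (p^`().[t^-1] * - (t ^- 2))); last first.
    by rewrite /flat t0 hornerM hornerXn hornerD hornerN exprVn; ring.
  apply: (@near_eq_is_derive _ _ _ (fun x => p.[x^-1] * expR (- x^-1))).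
    by near=> x; rewrite /flat ifT//; near: x; exact: lt_nbhsr.
  have tn0 : t != 0 by rewrite gt_eqF.
  have dV : is_derive t 1 (fun x : R => x^-1) (- t ^- 2).
    have := is_deriveV tn0 (is_derive_id t 1).
    by rewrite /GRing.scale/= mulr1.
  have d1 : is_derive t 1 (fun x => p.[x^-1]) (p^`().[t^-1] * - t ^- 2).
    exact: (is_derive1_comp (f := horner p) (is_derive_poly p t^-1) dV).
  have d2 : is_derive t 1 (fun x => expR (- x^-1)) (t ^- 2 * expR (- t^-1)).
    have := is_derive1_comp (f := expR) (g := fun x => - x^-1)
      (is_derive_expR (- t^-1)) (is_deriveN dV).
    by rewrite opprK mulrC.
  exact: (is_deriveM d1 d2).
- rewrite t0 [X in is_derive _ _ _ X](_ : _ = 0); last by rewrite /flat ltxx.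
  by have [C _ hC] := flat_quadratic p; exact: is_derive0_quadratic hC.
Unshelve. all: by end_near. Qed.

Lemma smooth_flat p : smoothR (flat p).
Proof.
apply: (smooth_class (P := fun f => exists p, f = flat p)); last by exists p.
move=> _ [q ->]; exists (flat ('X^2 * (q - q^`()))); first by eexists.
exact: is_derive_flat.
Qed.

(** The classical quotient [f t / (f t + f (d - t))] for [f = flat 1]. *)
Lemma smooth_step (d : R) : 0 < d -> exists S : R -> R,
  [/\ smoothR S, forall t, t <= 0 -> S t = 0 & forall t, d <= t -> S t = 1].
Proof.
move=> d0; have f1 t : 0 < t -> 0 < flat 1 t.
  by move=> t0; rewrite /flat t0 hornerE mul1r expR_gt0.
have f0 t : t <= 0 -> flat 1 t = 0 by move=> t0; rewrite /flat ltNge t0.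
have fge t : 0 <= flat 1 t.
  by case: (leP t 0) => t0; [rewrite f0|rewrite ltW// f1].
pose den t := flat 1 t + flat 1 (d - t).
have den0 t : den t != 0.
  rewrite gt_eqF// /den; case: (ltP 0 t) => t0.
    by rewrite ltr_pwDl// f1.
  by rewrite ltr_wpDl// f1// subr_gt0 (le_lt_trans t0).
exists (fun t => flat 1 t * (den t)^-1); split.
- apply: smoothM; first exact: smooth_flat.
  apply: smoothV => //; apply: smoothD; first exact: smooth_flat.
  apply: smooth_comp; first exact: smooth_flat.
  have := @smooth_affine (-1) d; congr smoothR.
  by apply/funext => t; rewrite mulN1r addrC.
- by move=> t t0; rewrite f0// mul0r.
- move=> t td; rewrite /den [flat 1 (d - t)]f0 ?subr_le0// addr0 divff//.
  by rewrite gt_eqF// f1// (lt_le_trans d0).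
Qed.

End SmoothFunctions.

(** * The window *)

Section Window.
Context {R : realType}.
Notation mu := (@lebesgue_measure R).
Implicit Types (t x : R) (k m n : int).

(** With [S] the smooth step of width [de], take
    [h t = al^(-1/2) sin (pi/2 S t) cos (pi/2 S (t - al))] and
    [th t = sin^2 (pi/2 S t)]. As [de <= al], the sine is 1 wherever the cosine
    is not, so [al h^2 = th t (1 - th (t - al)) = th t - th (t - al)]. *)
Lemma smooth_window (al de : R) : 0 < al -> 0 < de -> exists h th : R -> R,
  [/\ smoothR h, continuous th,
      (forall t, t <= 0 -> th t = 0) /\ (forall t, de <= t -> th t = 1),
      (forall t, t <= 0 \/ al + de <= t -> h t = 0) &
      de <= al -> forall t, al * h t ^+ 2 = th t - th (t - al)].
Proof.
move=> al0 de0; have [S [sS S0 S1]] := smooth_step de0.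
have sH : smoothR (fun t => pi / 2 * S t).
  by apply: smoothM; [exact: smooth_cst|exact: sS].
pose si t := sin (pi / 2 * S t); pose co t := cos (pi / 2 * S t).
have ssi : smoothR si by exact: (smooth_comp (@smooth_sin R) sH).
have sco : smoothR co by exact: (smooth_comp (@smooth_cos R) sH).
have si0 t : t <= 0 -> si t = 0 by move=> t0; rewrite /si S0// mulr0 sin0.
have co0 t : t <= 0 -> co t = 1 by move=> t0; rewrite /co S0// mulr0 cos0.
have si1 t : de <= t -> si t = 1 by move=> t0; rewrite /si S1// mulr1 sin_pihalf.
have co1 t : de <= t -> co t = 0 by move=> t0; rewrite /co S1// mulr1 cos_pihalf.
have cs t : co t ^+ 2 + si t ^+ 2 = 1 by exact: cos2Dsin2.
exists (fun t => Num.sqrt al^-1 * (si t * co (t - al))), (fun t => si t * si t).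
split.
- apply: smoothM; first exact: smooth_cst.
  apply: smoothM; first exact: ssi.
  apply: (smooth_comp sco).
  have := @smooth_affine _ 1 (- al); congr smoothR.
  by apply/funext => t; rewrite mul1r.
- by apply: smooth_continuous; exact: smoothM.
- by split => t ?; [rewrite si0 ?mul0r|rewrite si1 ?mulr1].
- move=> t [t0|t1]; first by rewrite si0// mul0r mulr0.
  by rewrite co1 ?mulr0// lerBrDl.
- move=> dal t; rewrite exprMn sqr_sqrtr ?invr_ge0 ?ltW//.
  rewrite mulVKf ?gt_eqF//.
  have [tal|tal] := leP t al.
    have tal0 : t - al <= 0 by rewrite subr_le0.
    by rewrite (co0 _ tal0) (si0 _ tal0) mulr1 mulr0 subr0 expr2.
  have tde : de <= t by rewrite (le_trans dal)// ltW.
  by have := cs (t - al); rewrite (si1 _ tde) mul1r; lra.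
Qed.

Lemma Rintegral_split (f : R -> R) (a b c : R) : a < b -> b < c -> continuous f ->
  \int[mu]_(t in `]a, c[) f t =
  \int[mu]_(t in `]a, b[) f t + \int[mu]_(t in `]b, c[) f t.
Proof.
move=> ab bc cf; have ic x y : mu.-integrable `]x, y[ (EFin \o f).
  exact: continuous_integrable_itv.
rewrite -(@Rintegral_itvB _ f (BRight a) (BLeft c) b) ?bnd_simp ?ltW//.
by rewrite -Rintegral_itv_bndo_bndc// addrC subrK.
Qed.

Lemma Rintegral_shift (f : R -> R) (a b s : R) : a < b -> continuous f ->
  \int[mu]_(t in `]a, b[) f (t + s) = \int[mu]_(t in `]a + s, b + s[) f t.
Proof.
move=> ab cf; have cs : continuous (fun t : R => t + s).
  by move=> t; apply: cvgD; [exact: cvg_id|exact: cvg_cst].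
have cfs : continuous (fun t => f (t + s)).
  by move=> t; apply: continuous_comp; [exact: cs|exact: cf].
rewrite !Rintegral_oo_cc//; have dF t : is_derive t 1 (fun t => t + s) 1.
  by apply: is_derive_eq; rewrite addr0.
have F1 : derive1 (fun t => t + s) = fun=> 1.
  by apply/funext => t; rewrite derive1E; case: (dF t).
have := integration_by_substitution_increasing (F := fun t => t + s) (G := f) (ltW ab).
rewrite F1 /Rintegral => -> //.
- congr fine; apply: eq_integral => t _ /=.
  by rewrite -[f (t + s)]mulr1.
- by move=> x y _ _; rewrite ltrD2r.
- by move=> x _; exact: cvg_cst.
- exact: is_cvg_cst.
- exact: is_cvg_cst.
- split => [x _||]; first by case: (dF x).
    by apply: cvg_at_right_filter; exact: cs.
  by apply: cvg_at_left_filter; exact: cs.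
- exact: continuous_subspaceT.
Qed.

Variables (al de : R) (h th : R -> R).
Hypotheses (al0 : 0 < al) (de0 : 0 < de) (deal : de <= al).
Hypothesis cth : continuous th.
Hypothesis th0 : forall t, t <= 0 -> th t = 0.
Hypothesis th1 : forall t, de <= t -> th t = 1.
Hypothesis h0 : forall t, t <= 0 \/ al + de <= t -> h t = 0.
Hypothesis hth : forall t, al * h t ^+ 2 = th t - th (t - al).

(** The two terms of [al h^2 = th t - th (t - al)] have the same integral
    against a function of period [al], up to a translation by [al]; what is left
    is the integral of [phi] over the last period, where the first term is 1. *)
Lemma window_periodization (phi : R -> R) x : continuous phi ->
  (forall t, phi (t + al) = phi t) ->
  \int[mu]_(t in `]x, x + (al + de)[) (h (t - x) ^+ 2 * phi t) =
  al^-1 * \int[mu]_(t in `]x + de, x + de + al[) phi t.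
Proof.
move=> cphi pphi.
have cthx y : continuous (fun t => th (t - y)).
  move=> t; apply: continuous_comp; last exact: cth.
  by apply: cvgB; [exact: cvg_id|exact: cvg_cst].
pose f1 t := th (t - x) * phi t; pose f2 t := th (t - (x + al)) * phi t.
have cf1 : continuous f1 by move=> t; apply: cvgM; [exact: cthx|exact: cphi].
have cf2 : continuous f2 by move=> t; apply: cvgM; [exact: cthx|exact: cphi].
have ic (f : R -> R) y z : continuous f -> mu.-integrable `]y, z[ (EFin \o f).
  exact: continuous_integrable_itv.
have -> : \int[mu]_(t in `]x, x + (al + de)[) (h (t - x) ^+ 2 * phi t) =
    al^-1 * \int[mu]_(t in `]x, x + (al + de)[) (f1 t - f2 t).
  rewrite -RintegralZl//; last by apply: ic => t; apply: cvgB; [exact: cf1|exact: cf2].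
  apply: eq_Rintegral => t _; rewrite /f1 /f2 -mulrBl mulrA; congr (_ * _).
  rewrite (_ : t - (x + al) = t - x - al); last by ring.
  by rewrite -hth mulKf ?gt_eqF.
congr (_ * _); rewrite RintegralB//; try exact: ic.
have [xd xa] : x < x + de /\ x < x + al by rewrite !ltrDl.
have [da aa] : x + de < x + (al + de) /\ x + al < x + (al + de).
  by rewrite !ltrD2l ltrDl ltrDr.
rewrite (Rintegral_split xd da cf1) (Rintegral_split xa aa cf2).
have -> : \int[mu]_(t in `]x, x + al[) f2 t = 0.
  transitivity (\int[mu]_(t in `]x, x + al[) 0); last by rewrite /Rintegral integral0.
  apply: eq_Rintegral => t /set_mem; rewrite /= in_itv/= => /andP[_ ty].
  by rewrite /f2 th0 ?mul0r// subr_le0 ltW.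
rewrite (_ : x + (al + de) = x + de + al); last by ring.
rewrite -(Rintegral_shift _ xd cf2).
have -> : \int[mu]_(t in `]x, x + de[) f2 (t + al) = \int[mu]_(t in `]x, x + de[) f1 t.
  apply: eq_Rintegral => t _; rewrite /f1 /f2 pphi; congr (th _ * _); ring.
rewrite add0r addrC addKr; apply: eq_Rintegral => t /set_mem.
by rewrite /= in_itv/= => /andP[ty _]; rewrite /f1 th1 ?mul1r// lerBrDl ltW.
Qed.

Lemma window_cos k x :
  \int[mu]_(t in `]x, x + (al + de)[) (h (t - x) ^+ 2 * cos (k%:~R * (2 * pi / al) * t))
   = (k == 0)%:R.
Proof.
rewrite (window_periodization (phi := fun t => cos (k%:~R * (2 * pi / al) * t))).
- by rewrite int_cos_period// mulKf// gt_eqF.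
- exact: continuous_cosM.
- move=> t; rewrite -[RHS](cosDint _ k); congr cos.
  by move: (pi : R) => p; field; rewrite gt_eqF.
Qed.

Lemma window_sin k x :
  \int[mu]_(t in `]x, x + (al + de)[) (h (t - x) ^+ 2 * sin (k%:~R * (2 * pi / al) * t))
   = 0.
Proof.
rewrite (window_periodization (phi := fun t => sin (k%:~R * (2 * pi / al) * t))).
- by rewrite int_sin_period// mulr0.
- exact: continuous_sinM.
- move=> t; rewrite -[RHS](sinDint _ k); congr sin.
  by move: (pi : R) => p; field; rewrite gt_eqF.
Qed.

(** Only the two integers [m0] and [m0 - 1] contribute, with [m0] the integral
    part of [t / al], and their contributions telescope to
    [(th (r + al) - th (r - al)) / al = 1 / al]. *)
Lemma window_sum t :
  (\esum_(m in [set: int]) ((h (t - al * m%:~R)) ^+ 2)%:E = (al^-1)%:E)%E.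
Proof.
pose m0 := Num.floor (t / al); pose r := t - al * m0%:~R.
have r0 : 0 <= r.
  by rewrite /r subr_ge0 mulrC -ler_pdivlMr//; exact: floor_le.
have r1 : r < al.
  rewrite /r ltrBlDr -[X in _ < X + _]mulr1 -mulrDr mulrC -ltr_pdivrMr//.
  by rewrite addrC; have := floorD1_gt (t / al); rewrite rmorphD.
have hr m : t - al * m%:~R = r + al * (m0 - m)%:~R.
  by rewrite /r rmorphB/=; ring.
have outside m : m != m0 -> m != m0 - 1 -> h (t - al * m%:~R) = 0.
  move=> mm0 mm1; rewrite hr; apply: h0.
  (* Any other translate is evaluated either left of 0 or right of
     [2 al >= al + de]. *)
  have [j0|j0] := ltP (m0 - m) 0.
    left; have : (m0 - m)%:~R <= -1 :> R by rewrite (ler_int _ _ (-1)); lia.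
    move: ((m0 - m)%:~R : R) => j j1; nra.
  right; have : 2 <= (m0 - m)%:~R :> R.
    rewrite (ler_int _ 2) ; move: mm0 mm1 => /eqP ? /eqP ?; lia.
  have := al0; have := deal; move: ((m0 - m)%:~R : R) => j; nra.
pose s := [:: m0; m0 - 1].
have -> : (\esum_(m in [set: int]) ((h (t - al * m%:~R)) ^+ 2)%:E =
           \esum_(m in [set` s]) ((h (t - al * m%:~R)) ^+ 2)%:E)%E.
  rewrite [RHS]esum_mkcond; apply: eq_esum => m _.
  case: ifPn => //; rewrite notin_setE/= => /negP; rewrite !inE negb_or => /andP[? ?].
  by rewrite outside// expr0n.
rewrite esum_fset; [|exact: finite_seq|by move=> i _; rewrite lee_fin sqr_ge0].
rewrite -fsbig_seq; last by rewrite /= andbT inE; lia.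
rewrite sumEFin big_cons big_seq1; congr EFin.
apply: (@mulfI _ al); first by rewrite gt_eqF.
rewrite divff ?gt_eqF// mulrDr !hth !hr subrr mulr0 addr0.
rewrite (_ : m0 - (m0 - 1) = 1) ?mulr1 ?addrK; last by ring.
have rd : de <= r + al by rewrite (le_trans deal)// lerDr.
have ra : r - al <= 0 by rewrite subr_le0 ltW.
by rewrite (th0 ra) (th1 rd) subr0 addrC subrK.
Qed.

End Window.

(** * The two lattices *)

Section Lattices.
Context {R : realType}.
Implicit Types (b : R) (z w : 'cV[R]_2) (m n : int).

(** The points of the rectangular lattice [b Z x 2 b Z], sheared along the
    frequency axis by the slope-one shear that a chirp realizes. *)
Definition tfpoint b (p : int * int) : 'cV[R]_2 :=
  \col_i (if i == 0 then b * p.1%:~R else b * p.1%:~R + 2 * b * p.2%:~R).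

Definition chirp_lattice b : set 'cV[R]_2 := range (tfpoint b).

Lemma cV2P z w : z 0 0 = w 0 0 -> z 1 0 = w 1 0 -> z = w.
Proof.
move=> h0 h1; apply/matrixP => i j; rewrite (ord1 j).
case: i => [[|[|//]] hi].
  by rewrite (_ : Ordinal hi = 0)//; exact/val_inj.
by rewrite (_ : Ordinal hi = 1)//; exact/val_inj.
Qed.

Lemma tfpoint0 b p : tfpoint b p 0 0 = b * p.1%:~R.
Proof. by rewrite mxE eqxx. Qed.

Lemma tfpoint1 b p : tfpoint b p 1 0 = b * p.1%:~R + 2 * b * p.2%:~R.
Proof. by rewrite mxE. Qed.

Lemma tfpoint_inj b : b != 0 -> injective (tfpoint b).
Proof.
move=> b0 [m n] [m' n'] E.
have E0 := congr1 (fun z : 'cV[R]_2 => z 0 0) E.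
have E1 := congr1 (fun z : 'cV[R]_2 => z 1 0) E.
rewrite /= !tfpoint0/= in E0; rewrite /= !tfpoint1/= in E1.
have mm := mulfI b0 E0.
have nn : n%:~R = n'%:~R :> R.
  apply: (@mulfI _ (2 * b)); first by rewrite mulf_neq0.
  by move: E1; rewrite E0 => /addrI.
by move/eqP: mm; move/eqP: nn; rewrite !eqr_int => /eqP -> /eqP ->.
Qed.

Lemma lattice_scale_mat2 b x y x' y' z : lattice (b *: mat2 x y x' y') z <->
  exists p q : int, z 0 0 = b * (x * p%:~R + y * q%:~R) /\
                    z 1 0 = b * (x' * p%:~R + y' * q%:~R).
Proof.
have E (k : 'cV[int]_2) : let v := (b *: mat2 x y x' y') *m map_mx intr k in
    v 0 0 = b * (x * (k 0 0)%:~R + y * (k 1 0)%:~R) /\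
    v 1 0 = b * (x' * (k 0 0)%:~R + y' * (k 1 0)%:~R).
  have l1 : lift ord0 (ord0 : 'I_1) = 1 :> 'I_2 by apply/val_inj.
  split; rewrite mxE big_ord_recl big_ord1 l1 !mxE eqxx /=.
    by rewrite mulrDr !mulrA.
  by rewrite mulrDr !mulrA.
split=> [[k _ <-]|[p [q [h0 h1]]]]; first by exists (k 0 0), (k 1 0).
pose k : 'cV[int]_2 := \col_i (if i == 0 then p else q).
exists k => //; have [e0 e1] := E k.
by apply: cV2P; rewrite ?e0 ?e1 ?h0 ?h1 !mxE.
Qed.

Lemma lattice_chirp1 b : lattice (b *: mat2 1 1 (- 1) 1) = chirp_lattice b.
Proof.
apply/seteqP; split => z.
  move=> /lattice_scale_mat2[p [q [h0 h1]]]; exists (p + q, - p) => //.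
  by apply: cV2P; rewrite ?tfpoint0 ?tfpoint1 ?h0 ?h1/= rmorphD ?rmorphN/=; ring.
move=> [[m n] _ <-]; apply/lattice_scale_mat2; exists (- n), (m + n).
by rewrite tfpoint0 tfpoint1 rmorphD rmorphN/=; split; ring.
Qed.

Lemma lattice_chirp2 b : lattice (b *: mat2 1 (- 1) 1 1) = chirp_lattice b.
Proof.
apply/seteqP; split => z.
  move=> /lattice_scale_mat2[p [q [h0 h1]]]; exists (p - q, q) => //.
  by apply: cV2P; rewrite ?tfpoint0 ?tfpoint1 ?h0 ?h1/= rmorphB/=; ring.
move=> [[m n] _ <-]; apply/lattice_scale_mat2; exists (m + n), n.
by rewrite tfpoint0 tfpoint1 rmorphD/=; split; ring.
Qed.

(** Pairing with the generators of indices [(0, 1)] and [(1, 0)] already forces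
    the two coordinates; conversely the pairing of two points is an integer
    determinant. *)
Lemma adjoint_chirp_lattice b : b != 0 ->
  adjoint_lattice (chirp_lattice b) = chirp_lattice (1 / (2 * b)).
Proof.
move=> b0; apply/seteqP; split => z.
  move=> zA.
  have /intrP[k hk] : sigma z (tfpoint b (0, 1)) \is a Num.int.
    by apply: zA; exists (0, 1).
  have /intrP[j hj] : sigma z (tfpoint b (1, 0)) \is a Num.int.
    by apply: zA; exists (1, 0).
  exists (k, - j) => //.
  move: hk hj; rewrite /sigma !tfpoint0 !tfpoint1 /= !mulr0 !mulr1 add0r addr0 subr0.
  move=> hk hj; apply: cV2P; rewrite ?tfpoint0 ?tfpoint1/= ?rmorphN/= -?hk -?hj.
    by field.
  by field.
move=> [[k l] _ <-] w [[m n] _ <-].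
rewrite (_ : sigma _ _ = (n * k - m * l)%:~R) ?intr_int//.
rewrite /sigma !tfpoint0 !tfpoint1 rmorphB !rmorphM/=; by field.
Qed.

Lemma mul_mat2 (x y z w x' y' z' w' : R) : mat2 x y z w *m mat2 x' y' z' w' =
  mat2 (x * x' + y * z') (x * y' + y * w') (z * x' + w * z') (z * y' + w * w').
Proof.
apply/matrixP => i j; rewrite !mxE big_ord_recl big_ord1 !mxE/=.
by case: (i == 0); case: (j == 0).
Qed.

Lemma scale_mat2 (r x y z w : R) :
  r *: mat2 x y z w = mat2 (r * x) (r * y) (r * z) (r * w).
Proof. by apply/matrixP => i j; rewrite !mxE; case: (i == 0); case: (j == 0). Qed.

Lemma trmx_mat2 (x y z w : R) : (mat2 x y z w)^T = mat2 x z y w.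
Proof. by apply/matrixP => i j; rewrite !mxE; case: (i == 0); case: (j == 0). Qed.

Lemma det_mat2 x y x' y' : \det (mat2 x y x' y' : 'M[R]_2) = x * y' - y * x'.
Proof.
rewrite (expand_det_row _ ord0) big_ord_recl big_ord1 /cofactor !det_mx11 !mxE/=.
by rewrite expr0 expr1; ring.
Qed.

Lemma covol_chirp_lattice b : 0 < b -> covol (chirp_lattice b) = 2 * b ^+ 2.
Proof.
move=> b0; have dE : \det (b *: mat2 1 (- 1) 1 1 : 'M[R]_2) = 2 * b ^+ 2.
  by rewrite detZ det_mat2; ring.
have b2 : 0 < 2 * b ^+ 2 by rewrite mulr_gt0// exprn_gt0.
rewrite -lattice_chirp2 covol_lattice; last by rewrite unitmxE dE unitfE gt_eqF.
by rewrite dE gtr0_norm.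
Qed.

End Lattices.

(** * Sums over the integers, and chirped windows *)

Section Sums.
Context {R : realType}.

(** A sum of nonnegative terms over the integers depends only on their even
    part. *)
Lemma esum_even_symmetrization (F G : int -> R) :
  (forall n, 0 <= F n) -> (forall n, 0 <= G n) ->
  (forall n, F n + F (- n) = G n + G (- n)) ->
  (\esum_(n in [set: int]) (F n)%:E = \esum_(n in [set: int]) (G n)%:E)%E.
Proof.
move=> F0 G0 FG.
have double (H : int -> R) : (forall n, 0 <= H n) ->
    (\esum_(n in [set: int]) (H n)%:E + \esum_(n in [set: int]) (H n)%:E =
     \esum_(n in [set: int]) (H n + H (- n))%:E)%E.
  move=> H0; have bijN : set_bij [set: int] [set: int] (@GRing.opp int).
    split; [by []|by move=> x y _ _; exact: oppr_inj|].
    by move=> x _; exists (- x); rewrite ?opprK.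
  rewrite {2}(reindex_esum [set: int] [set: int] (@GRing.opp int))// -esumD//.
    by move=> i _; rewrite lee_fin.
  by move=> i _; rewrite lee_fin.
have FE := double _ F0; have GE := double _ G0.
have E : (\esum_(n in [set: int]) (F n)%:E + \esum_(n in [set: int]) (F n)%:E =
     \esum_(n in [set: int]) (G n)%:E + \esum_(n in [set: int]) (G n)%:E)%E.
  by rewrite FE GE; apply: eq_esum => n _; rewrite FG.
have F1 : (0 <= \esum_(n in [set: int]) (F n)%:E)%E.
  by apply: esum_ge0 => n _; rewrite lee_fin.
have G1 : (0 <= \esum_(n in [set: int]) (G n)%:E)%E.
  by apply: esum_ge0 => n _; rewrite lee_fin.
move: E F1 G1; case: (\esum_(n in _) (F n)%:E)%E => [r| |];
  case: (\esum_(n in _) (G n)%:E)%E => [s| |] //=.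
by rewrite -!EFinD => -[] E _ _; congr EFin; lra.
Qed.

Definition int_of_nat (n : nat) : int := if odd n then Negz n./2 else Posz n./2.

Lemma int_of_nat_bij : set_bij [set: nat] [set: int] int_of_nat.
Proof.
split=> //.
- pose g (k : int) : nat := match k with Posz n => n.*2 | Negz n => n.*2.+1 end.
  have gK : cancel int_of_nat g.
    move=> n; rewrite /int_of_nat /g -[RHS]odd_double_half.
    by case: (odd n).
  by move=> x y _ _ xy; rewrite -(gK x) xy gK.
- move=> [n|n] _; [exists n.*2|exists n.*2.+1] => //.
    by rewrite /int_of_nat odd_double doubleK.
  by rewrite /int_of_nat /= odd_double /= uphalf_double.
Qed.

Lemma esum_intZl (c : R) (F : int -> \bar R) : 0 <= c ->
  (forall m, (0 <= F m)%E) ->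
  (\esum_(m in [set: int]) (c%:E * F m) = c%:E * \esum_(m in [set: int]) F m)%E.
Proof.
move=> c0 F0; rewrite !(reindex_esum setT setT int_of_nat _ int_of_nat_bij).
rewrite -!nneseries_esumT ?nneseriesZl//.
by move=> n; rewrite mule_ge0.
Qed.

(** Monotone convergence, after enumerating the integers. *)
Lemma esum_int_integral d (T : measurableType d) (mu : {measure set T -> \bar R})
    (F : int -> T -> \bar R) :
  (forall m, measurable_fun setT (F m)) -> (forall m x, (0 <= F m x)%E) ->
  (\esum_(m in [set: int]) \int[mu]_x F m x =
   \int[mu]_x \esum_(m in [set: int]) F m x)%E.
Proof.
move=> mF F0; rewrite (reindex_esum setT setT int_of_nat _ int_of_nat_bij).
rewrite -nneseries_esumT; last by move=> n; apply: integral_ge0 => x _.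
rewrite -integral_nneseries//; apply: eq_integral => x _.
rewrite nneseries_esumT//.
by rewrite [RHS](reindex_esum setT setT int_of_nat _ int_of_nat_bij).
Qed.

End Sums.

Section Gabor.
Context {R : realType}.
Notation mu := (@lebesgue_measure R).
Implicit Types (h H : R -> R) (t x b : R) (m n : int).

(** The window [H] multiplied by [exp (i pi t^2)]. *)
Definition chirp H : R -> R[i] := fun t =>
  (cos (pi * t ^+ 2) * H t) +i* (sin (pi * t ^+ 2) * H t).

(** The argument of the unimodular factor of a time-frequency shift of a
    chirped window by [tfpoint b p]. The cross term of [(t - x)^2] cancels the
    part [b m] of the frequency, so the frequency no longer depends on [m]: this
    is the effect of the shear. *)
Definition phase b (p : int * int) t : R :=
  pi * t ^+ 2 + pi * (b * p.1%:~R) ^+ 2 + p.2%:~R * (4 * pi * b) * t.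

Lemma gabor_chirp b p H t : gabor (chirp H) (tfpoint b p) t =
  (cos (phase b p t) * H (t - b * p.1%:~R)) +i*
  (sin (phase b p t) * H (t - b * p.1%:~R)).
Proof.
rewrite /gabor /tfshift /modulation /translation /chirp tfpoint0 tfpoint1.
set x := b * _; have -> : phase b p t =
    2 * pi * (x + 2 * b * p.2%:~R) * t + pi * (t - x) ^+ 2.
  by rewrite /phase -/x; ring.
rewrite cosD sinD /=; apply/eqP; rewrite eq_complex/=; apply/andP; split; apply/eqP; ring.
Qed.

Lemma normc_sqr (z : R[i]) :
  Normc.normc z ^+ 2 = complex.Re z ^+ 2 + complex.Im z ^+ 2.
Proof. by case: z => a b /=; rewrite sqr_sqrtr// addr_ge0// sqr_ge0. Qed.

Lemma Rintegral_support (f : R -> R) (D : set R) : (forall t, ~ D t -> f t = 0) ->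
  \int[mu]_t f t = \int[mu]_(t in D) f t.
Proof.
move=> f0; rewrite [RHS]Rintegral_mkcond; apply: eq_Rintegral => t _.
by rewrite patchE; case: ifPn => // /negP; rewrite inE => /f0.
Qed.

Lemma integral_support (f : R -> R) (D : set R) : (forall t, ~ D t -> f t = 0) ->
  (\int[mu]_t (f t)%:E = \int[mu]_(t in D) (f t)%:E)%E.
Proof.
move=> f0; rewrite [RHS]integral_mkcond; apply: eq_integral => t _.
by rewrite patchE; case: ifPn => // /negP; rewrite inE => /f0 ->.
Qed.

Lemma continuous_sqr (f : R -> R) : continuous f -> continuous (fun t => f t ^+ 2).
Proof.
move=> cf; rewrite (_ : (fun t => _) = (fun t => f t * f t)); last first.
  by apply/funext => t; rewrite expr2.
by move=> t; apply: cvgM; exact: cf.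
Qed.

Lemma continuous_phase b p : continuous (phase b p).
Proof.
move=> t; apply: cvgD; last by apply: cvgMr; exact: cvg_id.
apply: cvgD; last exact: cvg_cst.
apply: cvgMr; apply: (@continuous_sqr id) => s; exact: cvg_id.
Qed.

Lemma shifted_support H a x t : (forall t, t <= 0 \/ a <= t -> H t = 0) ->
  ~ (`]x, x + a[%classic : set R) t -> H (t - x) = 0.
Proof.
move=> H0 /=; rewrite in_itv/= => /negP; rewrite negb_and -!leNgt => /orP[tx|tx].
  by apply: H0; left; rewrite subr_le0.
by apply: H0; right; rewrite lerBrDl.
Qed.

Lemma square_integrable_gabor_chirp b p H a : continuous H ->
  (forall t, t <= 0 \/ a <= t -> H t = 0) ->
  square_integrable (gabor (chirp H) (tfpoint b p)).
Proof.
move=> cH H0; set x := b * p.1%:~R.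
have cHx : continuous (fun t => H (t - x)).
  move=> t; apply: continuous_comp; last exact: cH.
  by apply: cvgB; [exact: cvg_id|exact: cvg_cst].
have cph := @continuous_phase b p.
split.
- under eq_fun do rewrite gabor_chirp/=.
  apply: continuous_measurable_fun => t; apply: cvgM; last exact: cHx.
  by apply: continuous_comp; [exact: cph|exact: continuous_cos].
- under eq_fun do rewrite gabor_chirp/=.
  apply: continuous_measurable_fun => t; apply: cvgM; last exact: cHx.
  by apply: continuous_comp; [exact: cph|exact: continuous_sin].
- rewrite /sqnorm.
  under eq_integral => t _.
    rewrite normc_sqr gabor_chirp/= !exprMn -mulrDl cos2Dsin2 mul1r -/x; over.
  rewrite (@integral_support _ `]x, x + a[); last first.
    by move=> t /(shifted_support H0) ->; rewrite expr0n.
  have : mu.-integrable `]x, x + a[ (EFin \o (fun t => H (t - x) ^+ 2)).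
    exact/continuous_integrable_itv/continuous_sqr.
  move=> /integrableP[_]; apply: le_lt_trans.
  apply: ge0_le_integral => //.
  + by move=> t _; rewrite lee_fin sqr_ge0.
  + apply/measurable_EFinP/measurable_funX.
    apply: measurable_funS (continuous_measurable_fun cHx) => //.
  + by apply/measurableT_comp => //; apply/measurable_EFinP/measurable_funX;
    apply: measurable_funS (continuous_measurable_fun cHx).
  + by move=> t _; rewrite lee_fin ler_norm.
Qed.

Lemma Cc_infty_chirp H a : smoothR H ->
  (forall t, t <= 0 \/ a <= t -> H t = 0) -> Cc_infty (chirp H).
Proof.
move=> sH H0; have sq : smoothR (fun t : R => pi * t ^+ 2).
  apply: smoothM; first exact: smooth_cst.
  under eq_fun do rewrite expr2.
  apply: smoothM; exact: smooth_id.
split.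
  move=> n t; split.
    by apply: (smoothM (smooth_comp smooth_cos sq) sH).
  by apply: (smoothM (smooth_comp smooth_sin sq) sH).
apply: (subclosed_compact _ (@segment_compact _ 0 a)); first exact: closed_closure.
rewrite -[X in _ `<=` X]/(`[0, a]%classic).
have -> : `[0, a]%classic = closure (`[0, a]%classic : set R).
  by apply/closure_id; exact: itv_closed.
apply: closure_subset => t /=; apply: contra_neqP => /negP.
rewrite in_itv/= negb_and -!ltNge => ta.
rewrite /chirp (H0 t) ?mulr0//.
by case/orP: ta => /ltW; [left|right].
Qed.

End Gabor.

(** * Gabor systems of a chirped window over a sheared lattice *)

Section GaborLattice.
Context {R : realType}.
Notation mu := (@lebesgue_measure R).
Implicit Types (t x : R) (m n : int).

Lemma eq_complexP (u v : R[i]) : complex.Re u = complex.Re v ->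
  complex.Im u = complex.Im v -> u = v.
Proof. by case: u v => [a b] [c d] /= -> ->. Qed.

(** For distinct first indices the supports are disjoint; for equal ones the
    chirps cancel, and the inner product is a Fourier coefficient of the squared
    window. *)
Lemma orthonormal_gabor_chirp (a : R) (h : R -> R) : 0 < a -> continuous h ->
  (forall t, t <= 0 \/ a <= t -> h t = 0) ->
  (forall n x, \int[mu]_(t in `]x, x + a[)
     (h (t - x) ^+ 2 * cos (n%:~R * (4 * pi * a) * t)) = (n == 0)%:R) ->
  (forall n x, \int[mu]_(t in `]x, x + a[)
     (h (t - x) ^+ 2 * sin (n%:~R * (4 * pi * a) * t)) = 0) ->
  orthonormal_system (chirp_lattice a) (gabor (chirp h)).
Proof.
move=> a0 ch h0 hc hs; split.
  by move=> _ [p _ <-]; exact: square_integrable_gabor_chirp h0.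
move=> _ _ [p _ <-] [q _ <-].
pose prod t := h (t - a * p.1%:~R) * h (t - a * q.1%:~R).
have E t : gabor (chirp h) (tfpoint a p) t * conjc (gabor (chirp h) (tfpoint a q) t) =
    (prod t * cos (phase a p t - phase a q t)) +i*
    (prod t * sin (phase a p t - phase a q t)).
  rewrite !gabor_chirp cosB sinB /prod; apply: eq_complexP => /=; ring.
rewrite /inner /Cintegral.
under eq_Rintegral do rewrite E/=.
under [X in _ +i* X]eq_Rintegral do rewrite E/=.
rewrite (inj_eq (tfpoint_inj _)) ?gt_eqF//.
have [pq|pq] := eqVneq p.1 q.1; last first.
  have prod0 t : prod t = 0.
    have [ta|ta] := pselect
      ((`]a * p.1%:~R, a * p.1%:~R + a[%classic : set R) t); last first.
      by rewrite /prod (shifted_support h0 ta) mul0r.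
    have [tb|tb] := pselect
      ((`]a * q.1%:~R, a * q.1%:~R + a[%classic : set R) t); last first.
      by rewrite /prod (shifted_support h0 tb) mulr0.
    exfalso; move: ta tb; rewrite /= !in_itv/= => /andP[p1 p2] /andP[q1 q2].
    have : a * p.1%:~R < a * (q.1 + 1)%:~R.
      by rewrite rmorphD/= mulrDr mulr1 (lt_trans p1).
    have : a * q.1%:~R < a * (p.1 + 1)%:~R.
      by rewrite rmorphD/= mulrDr mulr1 (lt_trans q1).
    by rewrite !ltr_pM2l// !ltr_int; move/eqP: pq; lia.
  rewrite (_ : (p == q) = false); last by apply/eqP => e; rewrite e eqxx in pq.
  under eq_Rintegral do rewrite prod0 mul0r.
  under [X in _ +i* X]eq_Rintegral do rewrite prod0 mul0r.
  by rewrite /Rintegral integral0.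
have Eph t : phase a p t - phase a q t = (p.2 - q.2)%:~R * (4 * pi * a) * t.
  by rewrite /phase pq rmorphB/=; ring.
have Eprod t : prod t = h (t - a * p.1%:~R) ^+ 2 by rewrite /prod -pq expr2.
under eq_Rintegral do rewrite Eph Eprod.
under [X in _ +i* X]eq_Rintegral do rewrite Eph Eprod.
rewrite !(@Rintegral_support _ _ `]a * p.1%:~R, a * p.1%:~R + a[); last 2 first.
- by move=> t /(shifted_support h0) ->; rewrite expr0n mul0r.
- by move=> t /(shifted_support h0) ->; rewrite expr0n mul0r.
rewrite hc hs subr_eq0 (_ : (p == q) = (p.2 == q.2)); last first.
  by rewrite [LHS]/eq_op/= pq eqxx.
by apply: eq_complexP; case: (p.2 == q.2).
Qed.

Section Fiber.
Variables (a b : R) (H : R -> R).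
Hypotheses (a0 : 0 < a) (ab : a * (2 * b) = 1).
Hypothesis cH : continuous H.
Hypothesis H0 : forall t, t <= 0 \/ a <= t -> H t = 0.
Hypothesis sumH : forall t,
  (\esum_(m in [set: int]) (H (t - b * m%:~R) ^+ 2)%:E = (a^-1)%:E)%E.

Let HC t : H t ^+ 2 <= a^-1.
Proof.
rewrite -lee_fin -(sumH t); apply: esum_ge; exists [set 0].
  by split => //; exact: finite_set1.
by rewrite fsbig_set1 mulr0 subr0.
Qed.

(** Multiplying [f] by the translated window and by the conjugate of the
    unimodular factor that does not depend on [n] gives [U + i V], with [U] and
    [V] real and supported on an interval of length [a], such that the inner
    products are the Fourier coefficients of [U + i V]. Their squared
    moduli differ from the sums of the squared [cas] coefficients of [U] and [V]
    by terms that are odd in [n], so that [fourier_parseval] applies to [U] and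
    [V] separately. *)
Lemma gabor_chirp_fiber (f : R -> R[i]) m : square_integrable f ->
  (\esum_(n in [set: int])
     ((Normc.normc (inner f (gabor (chirp H) (tfpoint b (m, n))))) ^+ 2)%:E
   = a%:E * \int[mu]_t (Normc.normc (f t) ^+ 2 * H (t - b * m%:~R) ^+ 2)%:E)%E.
Proof.
move=> [mr mi fin]; set x := b * m%:~R.
pose psi t := pi * t ^+ 2 + pi * x ^+ 2.
pose fr t := complex.Re (f t); pose fi t := complex.Im (f t).
pose U t := (fr t * cos (psi t) + fi t * sin (psi t)) * H (t - x).
pose V t := (fi t * cos (psi t) - fr t * sin (psi t)) * H (t - x).
pose D : set R := `]x, x + a[%classic.
have mD : measurable D by exact: measurable_itv.
(* The frequency step of the lattice is exactly the reciprocal of the length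
   of the support. *)
have w_eq : 2 * pi / a = 4 * pi * b.
  have a_neq0 : a != 0 by rewrite gt_eqF.
  apply: (mulfI a_neq0); rewrite mulrC divfK//.
  by rewrite -[LHS]mul1r -ab; ring.
have UV t : U t ^+ 2 + V t ^+ 2 = Normc.normc (f t) ^+ 2 * H (t - x) ^+ 2.
  rewrite normc_sqr -/(fr t) -/(fi t) /U /V !exprMn -mulrDl; congr (_ * _).
  have := cos2Dsin2 (psi t); move: (cos _) (sin _) => c s cs.
  rewrite -[RHS]mulr1 -cs; ring.
have UVs t : ~ D t -> U t = 0 /\ V t = 0.
  by move=> /(shifted_support H0) Ht; rewrite /U /V Ht !mulr0.
have cHx : continuous (fun t => H (t - x)).
  move=> t; apply: continuous_comp; last exact: cH.
  by apply: cvgB; [exact: cvg_id|exact: cvg_cst].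
have cpsi : continuous psi.
  move=> t; apply: cvgD; last exact: cvg_cst.
  by apply: cvgMr; apply: (@continuous_sqr _ id) => s; exact: cvg_id.
have mcos : measurable_fun [set: R] (fun t => cos (psi t)).
  apply: continuous_measurable_fun => t.
  by apply: continuous_comp; [exact: cpsi|exact: continuous_cos].
have msin : measurable_fun [set: R] (fun t => sin (psi t)).
  apply: continuous_measurable_fun => t.
  by apply: continuous_comp; [exact: cpsi|exact: continuous_sin].
have mHx : measurable_fun [set: R] (fun t => H (t - x)).
  exact: continuous_measurable_fun.
have mU : measurable_fun [set: R] U.
  by apply: measurable_funM => //; apply: measurable_funD; exact: measurable_funM.
have mV : measurable_fun [set: R] V.
  by apply: measurable_funM => //; apply: measurable_funB; exact: measurable_funM.
have mN : measurable_fun [set: R] (fun t => Normc.normc (f t) ^+ 2).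
  under eq_fun do rewrite normc_sqr.
  by apply: measurable_funD; exact: measurable_funX.
have iN : mu.-integrable [set: R] (EFin \o (fun t => a^-1 * Normc.normc (f t) ^+ 2)).
  have := @integrableZl _ _ _ mu setT measurableT a^-1
    (EFin \o (fun t => Normc.normc (f t) ^+ 2)).
  apply; apply/integrableP; split; first exact/measurable_EFinP.
  by under eq_integral do rewrite /= ger0_norm ?sqr_ge0//.
have L2f (W : R -> R) : measurable_fun [set: R] W ->
    (forall t, W t ^+ 2 <= U t ^+ 2 + V t ^+ 2) -> L2 mu D W.
  move=> mW WUV; split; first exact: measurable_funS mW.
  apply: (@integrableS _ _ _ mu setT) => //.
  apply: le_integrable iN => //; first exact/measurable_EFinP/measurable_funX.
  move=> t _ /=; rewrite lee_fin ger0_norm ?sqr_ge0// (le_trans (WUV t))// UV.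
  rewrite ger0_norm; last by rewrite mulr_ge0 ?sqr_ge0// (le_trans _ (HC 0)) ?sqr_ge0.
  by rewrite mulrC ler_wpM2r ?sqr_ge0.
have LU : L2 mu D U by apply: L2f => // t; rewrite lerDl sqr_ge0.
have LV : L2 mu D V by apply: L2f => // t; rewrite lerDr sqr_ge0.
pose w := 2 * pi / a.
have LC n : L2 mu D (fun t => cos (n%:~R * w * t)).
  apply: (@L2_bounded _ _ _ mu D mD (period_finite x a) _ 1); last first.
    by move=> t _; exact: cos_max.
  exact: measurable_funS (continuous_measurable_fun (@continuous_cosM _ (n%:~R * w))).
have LS n : L2 mu D (fun t => sin (n%:~R * w * t)).
  apply: (@L2_bounded _ _ _ mu D mD (period_finite x a) _ 1); last first.
    by move=> t _; exact: sin_max.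
  exact: measurable_funS (continuous_measurable_fun (@continuous_sinM _ (n%:~R * w))).
pose A W n := dot mu D W (fun t => cos (n%:~R * w * t)).
pose B W n := dot mu D W (fun t => sin (n%:~R * w * t)).
have AN W n : A W (- n) = A W n.
  by rewrite /A /dot; apply: eq_Rintegral => t _; rewrite rmorphN/= !mulNr cosN.
have BN W n : L2 mu D W -> B W (- n) = - B W n.
  move=> LW; rewrite /B -[RHS]mulN1r [in RHS]dotC -dotZl// [RHS]dotC.
  by apply: eq_Rintegral => t _; rewrite rmorphN/= !mulNr sinN mul1r.
have Dcas W n : L2 mu D W -> dot mu D W (cas a n) = A W n + B W n.
  by move=> LW; rewrite /A /B ![dot _ _ W _]dotC dotDl.
have innerE n : inner f (gabor (chirp H) (tfpoint b (m, n))) =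
    (A U n + B V n) +i* (A V n - B U n).
  rewrite /inner /Cintegral /A /B /dot.
  have ph t : phase b (m, n) t = psi t + n%:~R * w * t by rewrite /phase /psi /w w_eq.
  have ER t : complex.Re (f t * conjc (gabor (chirp H) (tfpoint b (m, n)) t)) =
      U t * cos (n%:~R * w * t) + V t * sin (n%:~R * w * t).
    rewrite gabor_chirp ph -/x (cosD (psi t)) (sinD (psi t)) /U /V /fr /fi.
    by case: (f t) => r i /=; ring.
  have EI t : complex.Im (f t * conjc (gabor (chirp H) (tfpoint b (m, n)) t)) =
      V t * cos (n%:~R * w * t) - U t * sin (n%:~R * w * t).
    rewrite gabor_chirp ph -/x (cosD (psi t)) (sinD (psi t)) /U /V /fr /fi.
    by case: (f t) => r i /=; ring.
  congr (_ +i* _).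
    rewrite -RintegralD//; try exact: L2_mul.
    under eq_Rintegral do rewrite ER.
    by apply: Rintegral_support => t /UVs[-> ->]; rewrite !mul0r addr0.
  rewrite -RintegralB//; try exact: L2_mul.
  under eq_Rintegral do rewrite EI.
  by apply: Rintegral_support => t /UVs[-> ->]; rewrite !mul0r subr0.
under eq_esum => n _ do rewrite innerE normc_sqr/=.
rewrite (esum_even_symmetrization (G := fun n =>
  dot mu D U (cas a n) ^+ 2 + dot mu D V (cas a n) ^+ 2)); last 3 first.
- by move=> n; rewrite addr_ge0// sqr_ge0.
- by move=> n; rewrite addr_ge0// sqr_ge0.
- by move=> n; rewrite !Dcas// !AN !BN//; ring.
under eq_esum => n _ do rewrite EFinD.
rewrite esumD; last 2 first.
- by move=> i _; rewrite lee_fin sqr_ge0.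
- by move=> i _; rewrite lee_fin sqr_ge0.
rewrite !fourier_parseval// -EFinD -mulrDr EFinM; congr (_ * _)%E.
rewrite /dot -RintegralD//; try exact: L2_mul.
rewrite -(@Rintegral_support _ (fun t => U t * U t + V t * V t)); last first.
  by move=> t /UVs[-> ->]; rewrite !mul0r addr0.
rewrite /Rintegral fineK.
  by apply: eq_integral => t _; rewrite -UV !expr2.
rewrite (@integral_support _ _ D); last by move=> t /UVs[-> ->]; rewrite !mul0r addr0.
apply: integrable_fin_num => //.
have iUU : mu.-integrable D (EFin \o (fun t => U t * U t)) by exact: L2_mul.
have iVV : mu.-integrable D (EFin \o (fun t => V t * V t)) by exact: L2_mul.
by have := @integrableD _ _ _ mu D mD _ _ iUU iVV.
Qed.

(** Sum the identities [gabor_chirp_fiber] over the translates, exchange the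
    sum with the integral, and use that the squared translated windows add up to
    [1 / a]. *)
Lemma parseval_gabor_chirp : parseval_frame (chirp_lattice b) (gabor (chirp H)).
Proof.
split; first by move=> _ [p _ <-]; exact: square_integrable_gabor_chirp H0.
move=> f sf; have [mr mi _] := sf.
have b0 : b != 0.
  by apply/eqP => b0; move: ab; rewrite b0 !mulr0 => /esym/eqP; rewrite oner_eq0.
have bij : set_bij [set: int * int] (chirp_lattice b) (tfpoint b).
  split; [by move=> p _; exists p|by move=> p q _ _; exact: tfpoint_inj|by []].
rewrite (reindex_esum _ _ _ _ bij).
have -> : [set: int * int] = [set: int] `*`` (fun=> [set: int]).
  by apply/seteqP; split.
rewrite -(esum_esum (a := fun m n => ((Normc.normc (inner f
  (gabor (chirp H) (tfpoint b (m, n))))) ^+ 2)%:E)); last first.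
  by move=> m n _ _; rewrite lee_fin sqr_ge0.
under eq_esum => m _ do rewrite gabor_chirp_fiber//.
have mN : measurable_fun [set: R] (fun t => Normc.normc (f t) ^+ 2).
  under eq_fun do rewrite normc_sqr.
  by apply: measurable_funD; exact: measurable_funX.
have mHx m : measurable_fun [set: R] (fun t => H (t - b * m%:~R)).
  apply: continuous_measurable_fun => t; apply: continuous_comp; last exact: cH.
  by apply: cvgB; [exact: cvg_id|exact: cvg_cst].
have mF m : measurable_fun [set: R]
    (fun t => (Normc.normc (f t) ^+ 2 * H (t - b * m%:~R) ^+ 2)%:E).
  by apply/measurable_EFinP/measurable_funM => //; exact: measurable_funX.
have -> : (\esum_(m in [set: int]) (a%:E * \int[mu]_t
    (Normc.normc (f t) ^+ 2 * H (t - b * m%:~R) ^+ 2)%:E) =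
  \esum_(m in [set: int]) \int[mu]_t
    (a%:E * (Normc.normc (f t) ^+ 2 * H (t - b * m%:~R) ^+ 2)%:E))%E.
  apply: eq_esum => m _; rewrite ge0_integralZl//.
  - exact: mF.
  - by move=> t _; rewrite lee_fin mulr_ge0 ?sqr_ge0.
  - by rewrite lee_fin ltW.
rewrite (esum_int_integral mu (F := fun m t =>
  (a%:E * (Normc.normc (f t) ^+ 2 * H (t - b * m%:~R) ^+ 2)%:E)%E)).
- apply: eq_integral => t _.
  under eq_esum => m _ do rewrite -EFinM mulrA EFinM.
  rewrite esum_intZl; [|by exact: (mulr_ge0 (ltW a0) (sqr_ge0 _))|].
    by rewrite sumH -EFinM mulrAC divff ?gt_eqF// mul1r.
  by move=> m; rewrite lee_fin sqr_ge0.
- move=> m; apply: measurable_funeM; exact: mF.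
- move=> m t; rewrite -EFinM lee_fin.
  by rewrite (mulr_ge0 (ltW a0))// (mulr_ge0 (sqr_ge0 _) (sqr_ge0 _)).
Qed.

End Fiber.

End GaborLattice.

(** * The theorem *)

Theorem propositionC1 (R : realType) :
  let a : R := 71%:R / 100%:R in
  let Gamma0 := lattice (a *: mat2 1 1 (- 1) 1) in
  let Lambda0 := adjoint_lattice Gamma0 in
  let c : R := 1 / (Num.sqrt 2 * a) in
  let S : 'M[R]_2 := (1 / Num.sqrt 2) *: mat2 1 (- 1) 1 1 in
  [/\ exists g0 : R -> R[i],
        [/\ g0 <> (fun=> 0), Cc_infty g0,
            orthonormal_system Gamma0 (gabor g0) &
            let g := fun t => (Num.sqrt (covol Lambda0))%:C * g0 t in
            Cc_infty g /\ parseval_frame Lambda0 (gabor g)],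
      Lambda0 = lattice ((1 / (2 * a)) *: mat2 1 (- 1) 1 1),
      Lambda0 = lattice (c *: S),
      Sp2 S &
      forall i j, S i j != 0].
Proof.
move=> a Gamma0 Lambda0 c S.
have a0 : 0 < a by rewrite /a divr_gt0.
pose al : R := 1 / (2 * a); pose de := a - al.
have alE : al = 50 / 71 by rewrite /al /a; field.
have al0 : 0 < al by rewrite alE divr_gt0.
have de0 : 0 < de by rewrite /de alE /a; lra.
have deal : de <= al by rewrite /de alE /a; lra.
have aE : al + de = a by rewrite /de addrC subrK.
have GammaE : Gamma0 = chirp_lattice a by exact: lattice_chirp1.
have LambdaE : Lambda0 = chirp_lattice al.
  by rewrite /Lambda0 GammaE adjoint_chirp_lattice// gt_eqF.
have s2 : Num.sqrt 2 != 0 :> R by rewrite gt_eqF// sqrtr_gt0.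
have s22 : Num.sqrt 2 * Num.sqrt 2 = 2 :> R by rewrite -expr2 sqr_sqrtr.
split.
- have [h [th [sh cth [th0 th1] h0 hth]]] := smooth_window al0 de0.
  have {}hth := hth deal; rewrite aE in h0.
  have ch := smooth_continuous sh.
  have wE : 2 * pi / al = 4 * pi * a.
    by rewrite /al; move: (pi : R) => p; field; rewrite gt_eqF.
  have hc n x : \int[lebesgue_measure]_(t in `]x, x + a[)
      (h (t - x) ^+ 2 * cos (n%:~R * (4 * pi * a) * t)) = (n == 0)%:R :> R.
    rewrite -wE -[in X in `]x, x + X[]aE.
    exact: (window_cos al0 de0 cth th0 th1 hth).
  have hs n x : \int[lebesgue_measure]_(t in `]x, x + a[)
      (h (t - x) ^+ 2 * sin (n%:~R * (4 * pi * a) * t)) = 0 :> R.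
    rewrite -wE -[in X in `]x, x + X[]aE.
    exact: (window_sin al0 de0 cth th0 th1 hth).
  exists (chirp h); split.
  (* A zero window would contradict the normalization of [h^2]. *)
  + move=> ch0; have h_eq0 t : h t = 0.
      have := congr1 (fun g => g t) ch0; rewrite /chirp => -[ct st].
      rewrite -[h t]mul1r -(cos2Dsin2 (pi * t ^+ 2)) mulrDl !expr2 -!mulrA.
      by rewrite ct st !mulr0 addr0.
    have := hc 0 0; under eq_Rintegral do rewrite h_eq0 expr0n mul0r.
    by rewrite /Rintegral integral0 /= => /eqP; rewrite eq_sym oner_eq0.
  + exact: Cc_infty_chirp h0.
  + by rewrite GammaE; exact: orthonormal_gabor_chirp.
  + move=> g; pose s := Num.sqrt (covol Lambda0).
    have covE : covol Lambda0 = 2 * al ^+ 2.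
      by rewrite LambdaE covol_chirp_lattice.
    have ss : s ^+ 2 = 2 * al ^+ 2.
      by rewrite /s covE sqr_sqrtr// mulr_ge0// sqr_ge0.
    pose H t := s * h t.
    have gE : g = chirp H.
      apply/funext => t; rewrite /g /chirp /H -/s; apply: eq_complexP => /=; ring.
    have H0 t : t <= 0 \/ a <= t -> H t = 0.
      by move=> /h0; rewrite /H => ->; rewrite mulr0.
    have sH : smoothR H by apply: smoothM; [exact: smooth_cst|exact: sh].
    rewrite gE LambdaE; split; first exact: Cc_infty_chirp H0.
    apply: (parseval_gabor_chirp (a := a)) => //.
    * by rewrite /al; field; rewrite gt_eqF.
    * exact: smooth_continuous.
    (* The normalization: [2 al^2 / al = 2 al = 1 / a]. *)
    * move=> t; under eq_esum => m _ do rewrite /H exprMn EFinM.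
      rewrite esum_intZl ?sqr_ge0//; last by move=> m; rewrite lee_fin sqr_ge0.
      rewrite (window_sum al0 de0 deal th0 th1 _ hth) ?aE//.
      rewrite -EFinM ss; congr EFin; rewrite /al; field; rewrite gt_eqF//.
- by rewrite lattice_chirp2.
- rewrite LambdaE /S scalerA lattice_chirp2; congr chirp_lattice.
  rewrite /c /al -[2 in LHS]s22; field; rewrite s2 gt_eqF//.
- have r0 : 1 / Num.sqrt 2 != 0 :> R by rewrite mul1r invr_eq0.
  have r2 : (1 / Num.sqrt 2) * (1 / Num.sqrt 2) = 1 / 2 :> R.
    by rewrite mulf_div mulr1 s22.
  split.
    rewrite unitmxE /S detZ det_mat2 unitfE (_ : 1 * 1 - -1 * 1 = 2 :> R); last by ring.
    by rewrite mulf_neq0 ?expf_neq0.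
  rewrite /S scale_mat2 trmx_mat2 /Jmx !mul_mat2.
  by congr mat2; rewrite ?mulr0 ?mulr1 ?mulrN1 ?mulrN ?mulNr ?opprK ?r2; lra.
- move=> i j; rewrite /S !mxE mulf_neq0 ?mul1r ?invr_eq0//.
  by case: ifP => _; case: ifP => _; rewrite ?oppr_eq0 oner_eq0.
Qed.
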